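(* Let $v=(v^1,v^2,v^3)\in C_0^\infty(\mathbb{R}^3;\mathbb{R}^3)$ and $p\in C_0^\infty(\mathbb{R}^3)$ satisfy $$\sum_{j=1}^3\frac{\partial (v^iv^j)}{\partial x_j}+\frac{\partial p}{\partial x_i}=0\quad (i=1,2,3),$$ and let $w$ be the associated function on the manifold $M$ of oriented affine lines of $\mathbb{R}^3$. Then $$P^2w=-4\,\Delta_M w\quad\text{on } M .$$
   Context: $C_0^\infty$ denotes smooth compactly supported functions. $M$ is the manifold of oriented affine lines in $\mathbb{R}^3$ (identified with $T\mathbb{S}^2$). Function $w$: for $m\in M$, $$w(m)= -\int_{H(m)}\langle e_m,v\rangle \langle\nu_{H(m)},v\rangle \,d\sigma_{H(m)},$$ where $e_m$ is the positive unit direction vector of $m$, $H(m)$ is any half-plane with boundary line $m$, $d\sigma_{H(m)}$ its area element, and $\nu_{H(m)}$ the unit normal to $H(m)$ such that $(e_m,\nu_m,\nu_{H(m)})$ is positively oriented, $\nu_m$ being the unit vector parallel to $H(m)$, perpendicular to $m$ and pointing from $m$ into $H(m)$. The value does not depend on the choice of $H(m)$, and $w$ is a smooth compactly supported function on $M$. Coordinates: on the open set of non-horizontal lines, $m(y_1,y_2,\alpha_1,\alpha_2)$ denotes the line $\{(y_1+\alpha_1t,\,y_2+\alpha_2t,\,t):t\in\mathbb{R}\}$ oriented by increasing $t$; $0$ denotes the line $m(0,0,0,0)$, i.e. the upward oriented $x_3$-axis. Operators: $G=\mathbb{R}^3\rtimes \mathrm{SO}(3)$ is the group of proper rigid motions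 of $\mathbb{R}^3$, acting on $M$. For a function $f$ on $M$ and $g\in G$ put $f_g(m)=f(g^{-1}(m))$. Let $L=\frac{\partial^2}{\partial\alpha_2\partial y_1}-\frac{\partial^2}{\partial\alpha_1\partial y_2}$. For $f\in C^2(M)$ and $m_0\in M$, choose $g\in G$ with $g(m_0)=0$ and set $$Pf(m_0)=(Lf_g)(0),\qquad \Delta_Mf(m_0)=\Big(\frac{\partial^2 f_g}{\partial y_1^2}+\frac{\partial^2 f_g}{\partial y_2^2}\Big)(0);$$ these values do not depend on the choice of $g$. $P^2$ means $P\circ P$. *)

(* Defs.v *)
From HB Require Import structures.
From mathcomp Require Import all_boot all_order all_algebra.
From mathcomp Require Import ring lra.
From mathcomp Require Import all_classical all_reals all_analysis.

Set Implicit Arguments.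
Unset Strict Implicit.
Unset Printing Implicit Defensive.

Import Order.TTheory GRing.Theory Num.Theory.
Import numFieldNormedType.Exports.

Local Open Scope classical_set_scope.
Local Open Scope ring_scope.

(* Points and vectors of R^3 are row vectors, so matrices act on the right. *)

Section Euclidean3.
Context {R : realType}.
Implicit Types u v w : 'rV[R]_3.

Definition dot u v : R := \sum_(i < 3) u 0 i * v 0 i.

Definition vec3 (a b c : R) : 'rV[R]_3 := \row_(i < 3) [:: a; b; c]`_i.

Definition basis (i : 'I_3) : 'rV[R]_3 := delta_mx 0 i.

Definition rows3 u v w : 'M[R]_3 := \matrix_(i < 3) [:: u; v; w]`_i.

Definition positively_oriented u v w : Prop := 0 < \det (rows3 u v w).

Lemma dot_mxE u v : dot u v = (u *m v^T) 0 0.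
Proof. by rewrite mxE; apply: eq_bigr => i _; rewrite mxE. Qed.

Lemma dotC u v : dot u v = dot v u.
Proof. by apply: eq_bigr => i _; rewrite mulrC. Qed.

Lemma dotDl u v w : dot (u + v) w = dot u w + dot v w.
Proof. by rewrite !dot_mxE mulmxDl mxE. Qed.

Lemma dotZl a u v : dot (a *: u) v = a * dot u v.
Proof. by rewrite !dot_mxE -scalemxAl mxE. Qed.

Lemma dotNl u v : dot (- u) v = - dot u v.
Proof. by rewrite -scaleN1r dotZl mulN1r. Qed.

Lemma dotZr a u v : dot u (a *: v) = a * dot u v.
Proof. by rewrite dotC dotZl dotC. Qed.

Lemma dotE u v : dot u v = u 0 0 * v 0 0 + u 0 1 * v 0 1 + u 0 2 * v 0 2.
Proof.
rewrite /dot !big_ord_recl big_ord0 addr0 addrA.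
by congr (_ + _ * _ + _ * _); congr (_ _ _); apply: val_inj.
Qed.

Lemma vec3E a b c :
  (vec3 a b c 0 0 = a) * (vec3 a b c 0 1 = b) * (vec3 a b c 0 2 = c).
Proof. by rewrite !mxE. Qed.

Lemma vec3_eta u : u = vec3 (u 0 0) (u 0 1) (u 0 2).
Proof.
apply/rowP => i; rewrite mxE.
by case: i => [[|[|[|]]] //= hi]; congr (u _ _); apply: val_inj.
Qed.

Lemma dot_vec3 a b c a' b' c' :
  dot (vec3 a b c) (vec3 a' b' c') = a * a' + b * b' + c * c'.
Proof. by rewrite dotE !vec3E. Qed.

Lemma scale_vec3 x a b c : x *: vec3 a b c = vec3 (x * a) (x * b) (x * c).
Proof. by apply/rowP => i; rewrite !mxE; case: i => [[|[|[|]]]]. Qed.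

Lemma add_vec3 a b c a' b' c' :
  vec3 a b c + vec3 a' b' c' = vec3 (a + a') (b + b') (c + c').
Proof. by apply/rowP => i; rewrite !mxE; case: i => [[|[|[|]]]]. Qed.

Lemma rows3_dot u v w x :
  x *m (rows3 u v w)^T = vec3 (dot x u) (dot x v) (dot x w).
Proof.
apply/rowP => i; rewrite !mxE.
transitivity (dot x ([:: u; v; w]`_i)).
  by apply: eq_bigr => j _; rewrite !mxE.
by case: i => [[|[|[|]]]].
Qed.

Lemma det_rows3 a b c d e f g h i :
  \det (rows3 (vec3 a b c) (vec3 d e f) (vec3 g h i)) =
  a * (e * i - f * h) - b * (d * i - f * g) + c * (d * h - e * g).
Proof.
rewrite (expand_det_row _ 0) !big_ord_recl big_ord0 /cofactor.
rewrite !(expand_det_row _ 0) !big_ord_recl !big_ord0 /cofactor !det_mx11.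
rewrite !mxE /=.
by rewrite !(expr0, expr1, exprS) /=; ring.
Qed.

End Euclidean3.

Section SmoothFunctions.
Context {R : realType} {V W : normedModType R}.

(* f is C^infinity iff every iterated directional derivative exists and is
   Frechet differentiable at every point. *)
Definition smooth (f : V -> W) : Prop :=
  forall (s : seq V) (x : V),
    differentiable (foldr (fun u (h : V -> W) => 'D_u h) f s) x.

Definition smooth_compact_support (f : V -> W) : Prop :=
  smooth f /\ compact (closure [set x | f x != 0]).

End SmoothFunctions.

Section OrientedLines.
Context {R : realType}.

(* The model T S^2 of the manifold of oriented affine lines: a line is encoded
   by its unit direction and the foot of the perpendicular from the origin, so
   that equality of encodings is equality of oriented lines. *)
Record oline := OLine {
  dir : 'rV[R]_3;
  foot : 'rV[R]_3;
  dir_unit : dot dir dir = 1;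
  foot_perp : dot foot dir = 0
}.

Definition points (m : oline) : set 'rV[R]_3 :=
  [set foot m + t *: dir m | t in [set: R]].

Lemma dot_proj_perp (q u : 'rV[R]_3) :
  dot u u = 1 -> dot (q - dot q u *: u) u = 0.
Proof. by move=> h; rewrite dotDl dotNl dotZl h mulr1 subrr. Qed.

Definition line_through (q u : 'rV[R]_3) (hu : dot u u = 1) : oline :=
  OLine hu (dot_proj_perp q hu).

Lemma points_line_through (q u : 'rV[R]_3) (hu : dot u u = 1) :
  points (line_through q hu) = [set q + t *: u | t in [set: R]].
Proof.
apply/seteqP; split=> _ [t _ <-] /=.
  by exists (t - dot q u) => //; rewrite scalerBl addrA addrAC.
exists (t + dot q u) => //=.
by rewrite scalerDl (addrC (t *: u)) addrA subrK.
Qed.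

Lemma oline_eqP (m n : oline) : dir m = dir n -> points m = points n -> m = n.
Proof.
move=> edir epts; have : points n (foot m).
  by rewrite -epts; exists 0 => //=; rewrite scale0r addr0.
move=> [t _ et]; have t0 : t = 0.
  have := foot_perp m.
  by rewrite -et edir dotDl dotZl dir_unit mulr1 foot_perp add0r.
move: et; rewrite t0 scale0r addr0 {epts t t0}.
case: m n edir => [u q hu hq] [u' q' hu' hq'] /= eu eq; subst u' q'.
by rewrite (Prop_irrelevance hu hu') (Prop_irrelevance hq hq').
Qed.

(* Elements of G: the proper rigid motions x |-> x *m rot + trans. *)
Record motion := Motion {
  rot : 'M[R]_3;
  trans : 'rV[R]_3;
  rot_orth : rot *m rot^T = 1%:M;
  rot_det : \det rot = 1
}.

HB.instance Definition _ := gen_eqMixin motion.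
HB.instance Definition _ := gen_choiceMixin motion.

Definition motion_fun (g : motion) (x : 'rV[R]_3) := x *m rot g + trans g.

Lemma rot_orth_tr (g : motion) : (rot g)^T *m rot g = 1%:M.
Proof. exact/mulmx1C/rot_orth. Qed.

Lemma motion_id_orth : (1%:M : 'M[R]_3) *m 1%:M^T = 1%:M.
Proof. by rewrite trmx1 mulmx1. Qed.

Definition motion_id : motion := Motion 0 motion_id_orth (det1 R 3).

Lemma motion_inv_orth (g : motion) : (rot g)^T *m ((rot g)^T)^T = 1%:M.
Proof. by rewrite trmxK rot_orth_tr. Qed.

Lemma motion_inv_det (g : motion) : \det ((rot g)^T) = 1.
Proof. by rewrite det_tr rot_det. Qed.

Definition motion_inv (g : motion) : motion :=
  Motion (- (trans g *m (rot g)^T)) (motion_inv_orth g) (motion_inv_det g).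

Lemma motion_funK (g : motion) :
  cancel (motion_fun g) (motion_fun (motion_inv g)).
Proof.
by move=> x; rewrite /motion_fun /= mulmxDl -mulmxA rot_orth mulmx1 addrK.
Qed.

Lemma motion_funVK (g : motion) :
  cancel (motion_fun (motion_inv g)) (motion_fun g).
Proof.
move=> x; rewrite /motion_fun /= mulmxDl mulNmx -!mulmxA rot_orth_tr.
by rewrite !mulmx1 addrNK.
Qed.

Lemma dot_rot (g : motion) (u v : 'rV[R]_3) :
  dot (u *m rot g) (v *m rot g) = dot u v.
Proof. by rewrite !dot_mxE trmx_mul mulmxA -(mulmxA u) rot_orth mulmx1. Qed.

Lemma dir_rot_unit (g : motion) (m : oline) :
  dot (dir m *m rot g) (dir m *m rot g) = 1.
Proof. by rewrite dot_rot dir_unit. Qed.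

Definition act (g : motion) (m : oline) : oline :=
  line_through (motion_fun g (foot m)) (dir_rot_unit g m).

Lemma points_act (g : motion) (m : oline) :
  points (act g m) = motion_fun g @` points m.
Proof.
rewrite points_line_through; apply/seteqP; split=> x.
  move=> [t _ <-]; exists (foot m + t *: dir m); first by exists t.
  by rewrite /motion_fun mulmxDl -scalemxAl addrAC.
move=> [_ [t _ <-] <-]; exists t => //.
by rewrite /motion_fun mulmxDl -scalemxAl addrAC.
Qed.

Definition transport (f : oline -> R) (g : motion) : oline -> R :=
  fun m => f (act (motion_inv g) m).

Lemma coord_norm_gt0 (a1 a2 : R) : 0 < 1 + a1 ^+ 2 + a2 ^+ 2.
Proof. by have := sqr_ge0 a1; have := sqr_ge0 a2; lra. Qed.

Definition coord_dir (a1 a2 : R) : 'rV[R]_3 :=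
  (Num.sqrt (1 + a1 ^+ 2 + a2 ^+ 2))^-1 *: vec3 a1 a2 1.

Lemma coord_dir_unit (a1 a2 : R) : dot (coord_dir a1 a2) (coord_dir a1 a2) = 1.
Proof.
have h := coord_norm_gt0 a1 a2.
rewrite dotZl dotZr dot_vec3 mulrA -expr2 exprVn sqr_sqrtr ?ltW//.
have -> : a1 * a1 + a2 * a2 + 1 * 1 = 1 + a1 ^+ 2 + a2 ^+ 2 by ring.
by rewrite mulVf ?gt_eqF.
Qed.

Definition coord (y1 y2 a1 a2 : R) : oline :=
  line_through (vec3 y1 y2 0) (coord_dir_unit a1 a2).

Lemma points_coord (y1 y2 a1 a2 : R) :
  points (coord y1 y2 a1 a2) =
  [set vec3 (y1 + a1 * t) (y2 + a2 * t) t | t in [set: R]].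
Proof.
have h := coord_norm_gt0 a1 a2; have h' := h; rewrite -sqrtr_gt0 in h'.
set s := Num.sqrt _ in h'.
have s0 : s != 0 by rewrite gt_eqF.
rewrite points_line_through; apply/seteqP; split=> _ [t _ <-].
  exists (t / s) => //; rewrite /coord_dir -/s !scale_vec3 add_vec3.
  by congr vec3; field.
exists (t * s) => //; rewrite /coord_dir -/s !scale_vec3 add_vec3.
by congr vec3; field.
Qed.

(* The upward oriented x3-axis, written 0 in the coordinates above. *)
Definition axis : oline := coord 0 0 0 0.

Lemma dir_axis : dir axis = vec3 0 0 1.
Proof. by rewrite /= /coord_dir expr0n /= !addr0 sqrtr1 invr1 scale1r. Qed.

(* A half-plane H with boundary line m is determined by the unit vector nu
   perpendicular to m pointing from m into H; n is then its unit normal. *)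
Definition halfplane_frame (m : oline) (nu n : 'rV[R]_3) : Prop :=
  [/\ dot nu nu = 1 /\ dot nu (dir m) = 0,
      dot n n = 1, dot n (dir m) = 0 /\ dot n nu = 0
    & positively_oriented (dir m) nu n].

Lemma halfplane_frame_exists (m : oline) : exists nu n, halfplane_frame m nu n.
Proof.
case: m => u q hu hq; rewrite /halfplane_frame /positively_oriented /=.
move: hu; rewrite (vec3_eta u) {hq}.
set a := u 0 0; set b := u 0 1; set c := u 0 2; rewrite dot_vec3 => hu.
have [r0|r0] := eqVneq (a ^+ 2 + b ^+ 2) 0.
  have [a0 b0] : a = 0 /\ b = 0.
    have := sqr_ge0 a; have := sqr_ge0 b => hb ha.
    by split; apply/eqP; rewrite -sqrf_eq0; apply/eqP; lra.
  have hc : c * c = 1 by rewrite a0 b0 in hu; lra.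
  exists (vec3 1 0 0), (vec3 0 c 0).
  by rewrite det_rows3 !dot_vec3 a0 b0; split; [split|..|split|]; ring: hc || nra.
have rp : 0 < a ^+ 2 + b ^+ 2 by rewrite lt_def r0 addr_ge0 ?sqr_ge0.
pose s := Num.sqrt (a ^+ 2 + b ^+ 2).
have s0 : s != 0 by rewrite gt_eqF // sqrtr_gt0.
have ss : s ^+ 2 = a ^+ 2 + b ^+ 2 by rewrite sqr_sqrtr ?ltW.
have hc : c ^+ 2 = 1 - s ^+ 2 by rewrite ss; lra.
have hb : b ^+ 2 = s ^+ 2 - a ^+ 2 by rewrite ss; ring.
exists (vec3 (- b / s) (a / s) 0), (vec3 (- a * c / s) (- b * c / s) s).
rewrite det_rows3 !dot_vec3; split; [split|..|split|].
- by field: hb.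
- by field.
- by field: hb hc.
- by field: hb.
- by field.
- suff -> : a * (a / s * s - 0 * (- b * c / s)) - b * (- b / s * s - 0 * (- a * c / s)) +
     c * (- b / s * (- b * c / s) - a / s * (- a * c / s)) = 1 by [].
  by field: hb hc.
Qed.

Lemma motion_to_axis_exists (m : oline) : exists g, act g m = axis.
Proof.
have [nu [n [[nn ne] mm [me mn] hpos]]] := halfplane_frame_exists m.
pose A := (rows3 nu n (dir m))^T.
have hA : A^T *m A = 1%:M.
  rewrite trmxK; apply/row_matrixP => i; rewrite row_mul /A rows3_dot.
  rewrite (vec3_eta (row i 1%:M)).
  have -> : row i (rows3 nu n (dir m)) = [:: nu; n; dir m]`_i.
    by apply/rowP => j; rewrite !mxE.
  have en : dot (dir m) n = 0 by rewrite dotC.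
  have enu : dot (dir m) nu = 0 by rewrite dotC.
  have nun : dot nu n = 0 by rewrite dotC.
  have e1 := dir_unit m.
  by rewrite !mxE; case: i => [[|[|[|]]]] //= ?; congr vec3.
have detA : \det A = 1.
  have : (\det A) ^+ 2 = 1 by rewrite expr2 -{1}det_tr -det_mulmx hA det1.
  have : 0 < \det A.
    suff -> : \det A = \det (rows3 (dir m) nu n) by [].
    rewrite det_tr (vec3_eta nu) (vec3_eta n) (vec3_eta (dir m)) !det_rows3.
    by ring.
  by move=> d0 d1; nra.
exists (Motion (- (foot m *m A)) (mulmx1C hA) detA); apply: oline_eqP.
  by rewrite dir_axis /= rows3_dot dir_unit [dot (dir m) nu]dotC ne [dot _ n]dotC me.
rewrite points_line_through points_line_through /motion_fun /= subrr.
rewrite rows3_dot dir_unit [dot (dir m) nu]dotC ne [dot _ n]dotC me.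
rewrite (_ : vec3 0 0 0 = 0) -?dir_axis //.
by apply/rowP => i; rewrite !mxE; case: i => [[|[|[|]]]].
Qed.

End OrientedLines.
Arguments oline : clear implicits.
Arguments motion : clear implicits.

Section Operators.
Context {R : realType}.
Implicit Types (f : oline R -> R) (F : R -> R -> R -> R -> R).

Definition dy1 F := fun y1 y2 a1 a2 => derive1 (fun s => F s y2 a1 a2) y1.
Definition dy2 F := fun y1 y2 a1 a2 => derive1 (fun s => F y1 s a1 a2) y2.
Definition da1 F := fun y1 y2 a1 a2 => derive1 (fun s => F y1 y2 s a2) a1.
Definition da2 F := fun y1 y2 a1 a2 => derive1 (fun s => F y1 y2 a1 s) a2.

Definition in_coord f := fun y1 y2 a1 a2 => f (coord y1 y2 a1 a2).

Definition L0 f : R :=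
  da2 (dy1 (in_coord f)) 0 0 0 0 - da1 (dy2 (in_coord f)) 0 0 0 0.

Definition Lap0 f : R :=
  dy1 (dy1 (in_coord f)) 0 0 0 0 + dy2 (dy2 (in_coord f)) 0 0 0 0.

(* Some g in G with g(m) = 0; see motion_to_axis_exists. *)
Definition motion_to_axis (m : oline R) : motion R :=
  xget motion_id [set g | act g m = axis].

Definition P f : oline R -> R :=
  fun m => L0 (transport f (motion_to_axis m)).

Definition DeltaM f : oline R -> R :=
  fun m => Lap0 (transport f (motion_to_axis m)).

(* Some half-plane frame (nu_m, nu_H) at m; see halfplane_frame_exists. *)
Definition some_frame (m : oline R) : 'rV[R]_3 * 'rV[R]_3 :=
  xget (0, 0) [set h | halfplane_frame m h.1 h.2].

(* (s, t) |-> foot + s e + t nu, t >= 0, is an isometric parametrization of the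
   half-plane, so its area element is ds dt. *)
Definition halfplane_integral (v : 'rV[R]_3 -> 'rV[R]_3) (m : oline R)
    (nu n : 'rV[R]_3) : R :=
  \int[(lebesgue_measure \x lebesgue_measure)%E]_(z in [set z : R * R | 0 <= z.2])
    (let x := foot m + z.1 *: dir m + z.2 *: nu in
     dot (dir m) (v x) * dot n (v x)).

Definition wfun (v : 'rV[R]_3 -> 'rV[R]_3) : oline R -> R :=
  fun m => - halfplane_integral v m (some_frame m).1 (some_frame m).2.

Definition steady_euler (v : 'rV[R]_3 -> 'rV[R]_3) (p : 'rV[R]_3 -> R) : Prop :=
  forall (i : 'I_3) (x : 'rV[R]_3),
    \sum_(j < 3) 'D_(basis j) (fun y => v y 0 i * v y 0 j) x
    + 'D_(basis i) p x = 0.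

End Operators.

(* Main.v *)
Require Import Defs.
From mathcomp Require Import all_boot all_order all_algebra.
From mathcomp Require Import ring lra.
From mathcomp Require Import all_classical all_reals all_analysis measurable_realfun.
Set Implicit Arguments.
Unset Strict Implicit.
Unset Printing Implicit Defensive.
Import Order.TTheory GRing.Theory Num.Theory.
Import numFieldNormedType.Exports.
Local Open Scope classical_set_scope.
Local Open Scope ring_scope.

(** Write T(d, n) = <d, v> <n, v> and let X f (x, e) be the integral of f over
    the line x + R e. The equations of motion say that, for a fixed direction d,
    the vector field with components T(d, .) has divergence - D_d p.

    Cutting a half-plane into lines parallel to its edge gives
      w(m) = - int_0^oo X T(e, e x nu) (x + t nu, e) dt,
    where e is the direction of m and nu points into the half-plane. As X
    annihilates every derivative along e, the equation for d = e says that
    nu |-> X T(e, e x nu) is a closed 1-form in the directions transverse to e;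
    hence the integral does not change when the ray is turned or sheared
    ([flux_segment], [flux_indep]). This freedom is what makes w easy to
    differentiate: to move m in a direction a, let the half-plane be parallel
    to a, so that the displacement only shortens the rays and
      d_a w = X T(e, e x a)
    is an integral over the line itself ([dy1_wcoord], [dy2_wcoord]).

    Let (a, b, c) be a positive orthonormal frame whose third axis is along m.
    The nearby lines have directions proportional to c + alpha_1 a + alpha_2 b.
    Turning the direction of a line differentiates the dependence of the
    integrand on e and, because the points of the line move with a speed
    proportional to their abscissa s, adds the integral of s times a derivative
    of the integrand; the normalisation of the direction has no effect to first
    order ([derive_xray_unit_slope]).

    For w the resulting moments add up to that of D_a T(c, a) + D_b T(c, b),
    which is - D_c (T(c, c) + p); integrating by parts in s and adding the terms
    due to the dependence on e,
      P w = X (|v|^2 + p - 2 T(e, e))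
    ([L0_wcoord], [P_wfun]). When P is applied again, the moments contain the
    commutator of D_a and D_b and vanish, and only the dependence of T(e, e) on
    e survives:
      P (P w) = - 4 X (D_a T(c, b) - D_b T(c, a))
    ([L0_rcoord]). Differentiating d_a w = X T(c, b) along a and
    d_b w = - X T(c, a) along b, with the direction c kept fixed, shows that the
    last factor is Delta_M w ([Lap0_wcoord]). *)

(** * Integrals of compactly supported functions of one variable *)

Section CompactlySupportedIntegrals.
Context {R : realType}.
Notation mu := (@lebesgue_measure R).
Implicit Types (f g : R -> R) (D : set R) (N : R).

Definition vanishes_beyond N g := forall s, N < `|s| -> g s = 0.

Lemma vanishes_restrict N g : vanishes_beyond N g -> g \_ `[- N, N] = g.
Proof.
move=> g0; apply/funext => s; rewrite patchE; case: ifPn => //.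
rewrite notin_setE /= in_itv /= => /negP; rewrite -ler_norml -ltNge => sN.
by rewrite g0.
Qed.

Lemma vanishes_beyond_max N N' (g g' : R -> R) :
  vanishes_beyond N g -> vanishes_beyond N' g' ->
  vanishes_beyond (Num.max N N') g /\ vanishes_beyond (Num.max N N') g'.
Proof.
by move=> g0 g'0; split=> s; rewrite gt_max => /andP[? ?]; [exact: g0|exact: g'0].
Qed.

Lemma integrable_compact_support D N g : measurable D -> continuous g ->
  vanishes_beyond N g -> mu.-integrable D (EFin \o g).
Proof.
move=> mD cg g0; apply: (@integrableS _ _ R mu setT D) => //.
rewrite -(vanishes_restrict g0) -restrict_EFin.
apply/integrable_restrict => //; rewrite setTI.
apply: continuous_compact_integrable; first exact: segment_compact.
exact: continuous_subspaceT.
Qed.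

Lemma is_derive_continuous (V : normedModType R) (g g' : R -> V) :
  (forall s : R, is_derive s 1 g (g' s)) -> continuous g.
Proof.
move=> dg s; apply: differentiable_continuous.
by apply/derivable1_diffP; have [] := dg s.
Qed.

Lemma eq_of_derive0 (phi : R -> R) :
  (forall k : R, 0 <= k <= 1 -> is_derive k 1 phi 0) -> phi 1 = phi 0.
Proof.
move=> dphi.
have d01 (k : R) : k \in `]0, 1[ -> is_derive k 1 phi (cst 0 k).
  by move=> k01; apply: dphi; rewrite !ltW ?(itvP k01).
have c01 : {within `[0, 1], continuous phi}.
  apply: derivable_within_continuous => k; rewrite in_itv /= => k01.
  by have [] := dphi k k01.
have [k _] := MVT ltr01 d01 c01.
by rewrite mul0r => /eqP; rewrite subr_eq0 => /eqP.
Qed.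

Lemma Rintegral_derive_segment (g g' : R -> R) (a b : R) : a < b ->
  (forall s : R, is_derive s 1 g (g' s)) -> continuous g' ->
  \int[mu]_(s in `[a, b]) g' s = g b - g a.
Proof.
move=> ab dg cg'.
have cg := is_derive_continuous dg.
rewrite /Rintegral (@continuous_FTC2 _ g' g) //.
- exact: continuous_subspaceT.
- split.
  + by move=> s _; have [] := dg s.
  + exact/cvg_at_right_filter/cg.
  + exact/cvg_at_left_filter/cg.
- by move=> s _; rewrite derive1E; have [_ ->] := dg s.
Qed.

Lemma positive_bound N : exists2 M, 0 < M & N < M.
Proof. by exists (`|N| + 1); have := normr_ge0 N; have := ler_norm N; lra. Qed.

Lemma Rintegral_derive_line N (g g' : R -> R) :
  (forall s : R, is_derive s 1 g (g' s)) -> continuous g' ->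
  vanishes_beyond N g -> vanishes_beyond N g' ->
  \int[mu]_s g' s = 0.
Proof.
move=> dg cg' g0 g'0; have [M M0 NM] := positive_bound N.
have g'M : vanishes_beyond M g'.
  by move=> s Ms; apply: g'0; apply: lt_trans Ms.
rewrite -(vanishes_restrict g'M) -Rintegral_mkcond.
rewrite (Rintegral_derive_segment _ dg) //; last by lra.
by rewrite !g0 ?normrN ?(gtr0_norm M0) ?subrr.
Qed.

Lemma Rintegral_derive_ray N (g g' : R -> R) :
  (forall s : R, is_derive s 1 g (g' s)) -> continuous g' ->
  vanishes_beyond N g -> vanishes_beyond N g' ->
  \int[mu]_(s in `[0, +oo[) g' s = - g 0.
Proof.
move=> dg cg' g0 g'0; have [M M0 NM] := positive_bound N.
have g'M : vanishes_beyond M g'.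
  by move=> s Ms; apply: g'0; apply: lt_trans Ms.
rewrite -(vanishes_restrict g'M) -Rintegral_mkcondr.
have -> : `[0, +oo[ `&` `[- M, M] = `[0, M]%classic.
  apply/seteqP; split=> s /=; rewrite !in_itv /=; first by lra.
  by move=> ?; split; lra.
by rewrite (Rintegral_derive_segment _ dg) // (g0 M) ?(gtr0_norm M0) // sub0r.
Qed.

Lemma Rintegral_bounded N M g : continuous g -> vanishes_beyond N g ->
  (forall s, `|g s| <= M) -> 0 <= N -> `|\int[mu]_s g s| <= M * (N + N).
Proof.
move=> cg g0 gM N0.
have ig := integrable_compact_support measurableT cg g0.
rewrite (le_trans (le_normr_Rintegral measurableT ig)) //.
have ng0 : vanishes_beyond N (fun s => `|g s|).
  by move=> s Ns; rewrite g0 // normr0.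
rewrite -(vanishes_restrict ng0) -Rintegral_mkcond.
have -> : M * (N + N) = \int[mu]_(s in `[- N, N]) M.
  rewrite Rintegral_cst //= lebesgue_measure_itv /= lte_fin.
  case: ltP => [_|]; last first.
    move=> N0'; have -> : N = 0 by lra.
    by rewrite addr0.
  by rewrite -EFinD /= opprK.
apply: le_Rintegral => //.
- have: mu.-integrable `[- N, N] (EFin \o (fun s => `|g s|)).
    apply: (@integrable_compact_support _ N) => // s.
    by apply: continuous_comp; [exact: cg|exact: norm_continuous].
  by [].
- apply: continuous_compact_integrable; first exact: segment_compact.
  by apply: continuous_subspaceT => s; exact: cvg_cst.
Qed.

(** Outside the interval [-N, N] the integrand vanishes for all parameters near
    [k0], so the constant [M] on that interval dominates the derivatives. *)
Lemma derive_Rintegral_param D (F F' : R -> R -> R) (k0 dl N M : R) :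
  measurable D -> 0 < dl ->
  (forall k : R, `|k - k0| < dl -> continuous (F k)) ->
  (forall k : R, `|k - k0| < dl -> vanishes_beyond N (F k)) ->
  (forall k s : R, `|k - k0| < dl -> D s -> is_derive k 1 (F ^~ s) (F' k s)) ->
  (forall k s : R, `|k - k0| < dl -> D s -> `|s| <= N -> `|F' k s| <= M) ->
  is_derive k0 1 (fun k => \int[mu]_(s in D) F k s) (\int[mu]_(s in D) F' k0 s).
Proof.
move=> mD dl0 cF F0 dF F'M.
have k0I : `](k0 - dl), (k0 + dl)[%classic k0 by rewrite /= in_itv /=; lra.
have inI (k : R) : `](k0 - dl), (k0 + dl)[%classic k -> `|k - k0| < dl.
  by rewrite /= in_itv /= => /andP[? ?]; rewrite ltr_norml; lra.
have intF (k : R) : `](k0 - dl), (k0 + dl)[%classic k ->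
    mu.-integrable D (EFin \o F k).
  by move=> /inI kI; apply: (@integrable_compact_support _ N); auto.
have derF (k s : R) : `](k0 - dl), (k0 + dl)[%classic k -> D s ->
    derivable (F ^~ s) k 1.
  by move=> /inI kI Ds; have [] := dF k s kI Ds.
pose G := (cst `|M| : R -> R) \_ `[- N, N].
have intG : mu.-integrable D (EFin \o G).
  apply: (@integrableS _ _ R mu setT D) => //.
  rewrite /G -restrict_EFin; apply/integrable_restrict => //; rewrite setTI.
  apply: continuous_compact_integrable; first exact: segment_compact.
  by apply: continuous_subspaceT => s; exact: cvg_cst.
have G0 s : 0 <= G s by rewrite /G patchE; case: ifP.
have d1F (k s : R) : `](k0 - dl), (k0 + dl)[%classic k -> D s ->
    partial1of2 F k s = F' k s.
  by move=> /inI kI Ds; rewrite partial1of2E; have [_ ->] := dF k s kI Ds.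
have ubF (k s : R) : `](k0 - dl), (k0 + dl)[%classic k -> D s ->
    `|partial1of2 F k s| <= G s.
  move=> kI Ds; rewrite d1F // /G patchE; case: ifPn.
    rewrite inE /= in_itv /= -ler_norml => sN.
    by rewrite (le_trans _ (ler_norm M)) // F'M //; exact: inI.
  rewrite notin_setE /= in_itv /= => /negP; rewrite -ler_norml -ltNge => sN.
  have [_ <-] := dF k s (inI _ kI) Ds.
  (* Beyond [N] the function of the parameter is locally zero. *)
  suff -> : 'D_1 (F ^~ s) k = 'D_1 (cst 0 : R -> R) k.
    by rewrite derive_cst normr0.
  apply: near_eq_derive.
  have : \forall y \near k, y \in `](k0 - dl), (k0 + dl)[ by exact: near_in_itvoo.
  by apply: filterS => y /inI yI; rewrite F0.
split.
  exact: (@derivable_under_integral R _ _ mu F D mD k0 _ _ k0I intF derF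
    G G0 intG ubF).
rewrite -derive1E
  (@differentiation_under_integral R _ _ mu F D mD k0 _ _ k0I intF derF
    G G0 intG ubF).
by apply: eq_Rintegral => s; rewrite inE => Ds; rewrite d1F.
Qed.

End CompactlySupportedIntegrals.

(** * Directional derivatives *)

Section DirectionalDerivatives.
Context {R : realType} {V W : normedModType R}.
Implicit Types (f g : V -> W) (u w x : V).

Lemma is_derive_affine x u (s : R) : is_derive s 1 (fun s : R => x + s *: u) u.
Proof.
have ds : differentiable (fun s : R => s *: u) s by exact: ex_diff.
have d2 : is_derive s 1 (fun s : R => s *: u) u.
  apply: DeriveDef; first exact: diff_derivable.
  by rewrite deriveE // diff_val scale1r.
have := is_deriveD (is_derive_cst x s 1) d2.
by rewrite add0r.
Qed.

Lemma is_derive_curve f (c : R -> V) (c' : V) (s : R) :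
  differentiable f (c s) -> is_derive s 1 c c' ->
  is_derive s 1 (fun s => f (c s)) ('D_c' f (c s)).
Proof.
move=> df [dc <-].
have dc' : differentiable c s by apply/derivable1_diffP.
have dfc : differentiable (f \o c) s by exact: differentiable_comp.
apply: DeriveDef; first exact: (diff_derivable dfc).
rewrite -[LHS]/('D_1 (f \o c) s) !deriveE // diff_comp //.
Qed.

Lemma deriveDdir f x u w : differentiable f x ->
  'D_(u + w) f x = 'D_u f x + 'D_w f x.
Proof. by move=> df; rewrite !deriveE // linearD. Qed.

Lemma deriveZdir f x k u : differentiable f x ->
  'D_(k *: u) f x = k *: 'D_u f x.
Proof. by move=> df; rewrite !deriveE // linearZ. Qed.

(** Smoothness up to a finite order, defined by recursion so that closure under
    sums and products is a plain induction. *)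
Fixpoint Cn (n : nat) f : Prop :=
  if n is n'.+1 then (forall x, differentiable f x) /\ forall u, Cn n' ('D_u f)
  else continuous f.

Lemma CnW n f : Cn n.+1 f -> Cn n f.
Proof.
elim: n f => [|n IH] f [df Df]; first by move=> x; exact: differentiable_continuous.
by split=> // u; exact: IH.
Qed.

Lemma Cn_le m n f : (m <= n)%N -> Cn n f -> Cn m f.
Proof.
elim: n => [|n IH]; first by rewrite leqn0 => /eqP ->.
by rewrite leq_eqVlt => /predU1P[-> //|mn /CnW]; exact: IH.
Qed.

Lemma smooth_Cn n f : smooth f -> Cn n f.
Proof.
elim: n f => [|n IH] f sf.
  by move=> x; apply: differentiable_continuous; exact: (sf [::]).
split=> [x|u]; first exact: (sf [::]).
apply: IH => s x; have := sf (rcons s u) x.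
by rewrite foldr_rcons.
Qed.

Lemma CnD n f g : Cn n f -> Cn n g -> Cn n (f + g).
Proof.
elim: n f g => [|n IH] f g; first by move=> cf cg x; apply: cvgD; [exact: cf|exact: cg].
move=> [df Df] [dg Dg]; split=> [x|u]; first exact: differentiableD.
have -> : 'D_u (f + g) = 'D_u f + 'D_u g.
  by apply/funext => x; rewrite deriveD //; exact: diff_derivable.
by apply: IH; [exact: Df|exact: Dg].
Qed.

Lemma CnZ n k f : Cn n f -> Cn n (k \*: f).
Proof.
elim: n f => [|n IH] f; first by move=> cf x; apply: cvgZl_tmp; exact: cf.
move=> [df Df]; split=> [x|u]; first exact: differentiableZ.
have -> : 'D_u (k \*: f) = k \*: 'D_u f.
  by apply/funext => x; rewrite deriveZ //; exact: diff_derivable.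
exact: IH (Df u).
Qed.

End DirectionalDerivatives.

Section ScalarFunctions.
Context {R : realType} {V : normedModType R}.
Implicit Types (f g : V -> R) (a b u x : V).

Lemma CnM n f g : Cn n f -> Cn n g -> Cn n (f * g).
Proof.
elim: n f g => [|n IH] f g; first by move=> cf cg x; apply: cvgM; [exact: cf|exact: cg].
move=> Cf Cg; have [df Df] := Cf; have [dg Dg] := Cg.
split=> [x|u]; first exact: differentiableM.
have -> : 'D_u (f * g) = f * 'D_u g + g * 'D_u f.
  by apply/funext => x; rewrite deriveM //; exact: diff_derivable.
by apply: CnD; apply: IH; [exact: CnW|exact: Dg|exact: CnW|exact: Df].
Qed.

(** Two applications of the mean value theorem to a function that is symmetric
    in [a] and [b] up to the order of addition; this is the usual route to the
    symmetry of second derivatives. *)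
Lemma second_difference f a b x h : Cn 2 f -> 0 < h ->
  exists s t, [/\ 0 <= s <= h, 0 <= t <= h &
    f (x + h *: a + h *: b) - f (x + h *: a) - f (x + h *: b) + f x =
    'D_b ('D_a f) (x + s *: a + t *: b) * h * h].
Proof.
move=> [df Df] h0.
pose phi s := f (x + h *: b + s *: a) - f (x + s *: a).
pose dphi s := 'D_a f (x + h *: b + s *: a) - 'D_a f (x + s *: a).
have dphiP (s : R) : is_derive s 1 phi (dphi s).
  by apply: is_deriveB; apply: is_derive_curve => //; exact: is_derive_affine.
have [s sh phiE] := MVT h0 (fun s _ => dphiP s)
  (continuous_subspaceT (is_derive_continuous dphiP)).
pose psi t := 'D_a f (x + s *: a + t *: b).
pose dpsi t := 'D_b ('D_a f) (x + s *: a + t *: b).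
have dpsiP (t : R) : is_derive t 1 psi (dpsi t).
  apply: is_derive_curve; last exact: is_derive_affine.
  by have [dDf _] := Df a.
have [t th psiE] := MVT h0 (fun s _ => dpsiP s)
  (continuous_subspaceT (is_derive_continuous dpsiP)).
exists s, t; split; rewrite ?(itvP sh) ?(itvP th) //.
move: phiE psiE; rewrite /phi /dphi /psi /dpsi !scale0r !addr0 !subr0.
rewrite ![x + h *: b + _ *: a]addrAC => phiE psiE; rewrite -psiE -phiE.
ring.
Qed.

Lemma derive_comm f a b x : Cn 2 f -> 'D_b ('D_a f) x = 'D_a ('D_b f) x.
Proof.
move=> C2; have [_ Df] := C2.
have c1 : continuous ('D_b ('D_a f)) by exact: ((Df a).2 b).
have c2 : continuous ('D_a ('D_b f)) by exact: ((Df b).2 a).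
apply/eqP; rewrite -subr_eq0 -normr_le0; apply/ler_addgt0Pl => e e0.
rewrite addr0.
have e2 : 0 < e / 2 by lra.
have /cvgrPdist_lt /(_ _ e2) /nbhs_ballP[d1 /= d10 n1] := c1 x.
have /cvgrPdist_lt /(_ _ e2) /nbhs_ballP[d2 /= d20 n2] := c2 x.
pose S := `|a| + `|b| + 1.
have a0 := normr_ge0 a; have b0 := normr_ge0 b.
have S0 : 0 < S by rewrite /S; lra.
pose h := Num.min d1 d2 / S.
have h0 : 0 < h by rewrite divr_gt0 // lt_min d10.
have near_x (s t : R) a' b' : 0 <= s <= h -> 0 <= t <= h -> `|a'| + `|b'| + 1 = S ->
    `|x - (x + s *: a' + t *: b')| < Num.min d1 d2.
  move=> sh th S'; rewrite -addrA opprD addNKr normrN.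
  apply: (@le_lt_trans _ _ (h * (`|a'| + `|b'|))).
    rewrite (le_trans (ler_normD _ _)) // !normrZ mulrDr lerD // ler_wpM2r //.
      by rewrite ger0_norm; lra.
    by rewrite ger0_norm; lra.
  have -> : Num.min d1 d2 = h * S by rewrite /h divfK // gt_eqF.
  by rewrite ltr_pM2l // -S'; lra.
have [s [t [sh th E1]]] := second_difference a b x C2 h0.
have [s' [t' [sh' th' E2]]] := second_difference b a x C2 h0.
have E : 'D_b ('D_a f) (x + s *: a + t *: b) = 'D_a ('D_b f) (x + s' *: b + t' *: a).
  apply: (@mulIf _ h); first by rewrite gt_eqF.
  apply: (@mulIf _ h); first by rewrite gt_eqF.
  apply: (etrans (esym E1)); apply: (etrans _ E2).
  rewrite [x + h *: b + _]addrAC; ring.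
rewrite -ball_normE in n1; rewrite -ball_normE in n2.
have md1 : Num.min d1 d2 <= d1 by rewrite ge_min lexx.
have md2 : Num.min d1 d2 <= d2 by rewrite ge_min lexx orbT.
have S' : `|b| + `|a| + 1 = S by rewrite /S (addrC `|b|).
have m1 := n1 _ (lt_le_trans (near_x _ _ a b sh th erefl) md1).
have m2 := n2 _ (lt_le_trans (near_x _ _ b a sh' th' S') md2).
rewrite /= E in m1; rewrite /= in m2.
apply: le_trans (ler_distD ('D_a ('D_b f) (x + s' *: b + t' *: a)) _ _) _.
rewrite (splitr e); apply: lerD; first exact: (ltW m1).
by rewrite distrC; exact: (ltW m2).
Qed.

End ScalarFunctions.

(** * Compactly supported functions on three-space *)

Section TameFunctions.
Context {R : realType}.
Implicit Types (f g : 'rV[R]_3 -> R) (u x : 'rV[R]_3).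

Lemma scalefE k (f : 'rV[R]_3 -> R) x : (k \*: f) x = k * f x.
Proof. by []. Qed.

Lemma vanishes_outside_ball (W : normedModType R) (f : 'rV[R]_3 -> W) :
  compact (closure [set x | f x != 0]) -> exists r, forall x, r < `|x| -> f x = 0.
Proof.
move=> /compact_bounded [M [_ HM]]; exists (M + 1) => x Mx.
apply/eqP/negPn/negP => fx.
have M1 : M < M + 1 by lra.
have := HM _ M1 x; rewrite /= => H.
have : `|x| <= M + 1 by apply: H; exact: subset_closure.
by lra.
Qed.

(** The integrands below: finitely many continuous derivatives, zero outside a
    ball. *)
Definition tame n f := Cn n f /\ exists r, forall x, r < `|x| -> f x = 0.

Lemma tame_le m n f : (m <= n)%N -> tame n f -> tame m f.
Proof. by move=> mn [Cf bf]; split => //; exact: Cn_le Cf. Qed.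

Lemma tame_cont n f : tame n f -> continuous f.
Proof. by move=> /(tame_le (leq0n n)) []. Qed.

Lemma tame_diff n f x : tame n.+1 f -> differentiable f x.
Proof. by case; case. Qed.

Lemma tame_derive n f u : tame n.+1 f -> tame n ('D_u f).
Proof.
move=> [[df Df] [r f0]]; split; first exact: Df.
exists r => x rx.
have -> : 'D_u f x = 'D_u (cst 0 : _ -> R) x; last by rewrite derive_cst.
apply: near_eq_derive.
have : \forall y \near x, r < `|y| by apply: (cvgr_gt _ (@norm_continuous _ _ x)).
by apply: filterS => y /f0.
Qed.

Lemma tameD n f g : tame n f -> tame n g -> tame n (f + g).
Proof.
move=> [Cf [r f0]] [Cg [r' g0]]; split; first exact: CnD.
exists (Num.max r r') => x; rewrite gt_max => /andP[rx rx'].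
by rewrite -[LHS]/(f x + g x) (f0 x rx) (g0 x rx') addr0.
Qed.

Lemma tameZ n k f : tame n f -> tame n (k \*: f).
Proof.
move=> [Cf [r f0]]; split; first exact: CnZ.
by exists r => x rx; rewrite -[LHS]/(k * f x) f0 // mulr0.
Qed.

Lemma tame_derive_lin n f0 f1 k u : tame n.+1 f0 -> tame n.+1 f1 ->
  'D_u (f0 + k \*: f1) = 'D_u f0 + k \*: 'D_u f1 :> ('rV[R]_3 -> R).
Proof.
move=> t0 t1; apply/funext => y.
have d0 := diff_derivable (v := u) (tame_diff y t0).
have d1 := diff_derivable (v := u) (tame_diff y t1).
exact: (@derive_val _ _ _ _ _ _ _
  (is_deriveD (derivableP d0) (is_deriveZ _ (derivableP d1)))).
Qed.

Lemma derive_scaledir n f k u : tame n.+1 f -> 'D_(k *: u) f = k \*: 'D_u f.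
Proof. by move=> tf; apply/funext => y; rewrite deriveZdir //; exact: tame_diff tf. Qed.

Lemma tame_bounded n f : tame n f -> exists2 M, 0 <= M & forall x, `|f x| <= M.
Proof.
move=> tf; have cf := tame_cont tf; have [_ [r f0]] := tf.
pose B := closed_ball (0 : 'rV[R]_3) (`|r| + 1).
have r0 : 0 < `|r| + 1 by have := normr_ge0 r; lra.
have Bbd : bounded_set B.
  exists (`|r| + 1); split; first by rewrite realE ltW.
  move=> M rM x; rewrite /B closed_ballE // /closed_ball_ /= sub0r normrN => xr.
  by rewrite (le_trans xr) // ltW.
have Bc : compact B := bounded_closed_compact Bbd (@closed_ball_closed _ _ _ _).
have fBc : compact (f @` B).
  by apply: continuous_compact => //; exact: continuous_subspaceT.
have [M [_ fM]] := compact_bounded fBc.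
exists (`|M| + 1); first by have := normr_ge0 M; lra.
move=> x; have [rx|xr] := ltP r `|x|.
  by rewrite f0 // normr0; have := normr_ge0 M; lra.
apply: fM; first by have := ler_norm M; lra.
exists x => //; rewrite /B closed_ballE // /closed_ball_ /= sub0r normrN.
by have := ler_norm r; lra.
Qed.

Lemma Cn_coord n (v : 'rV[R]_3 -> 'rV[R]_3) (i : 'I_3) :
  Cn n v -> Cn n (fun x => v x 0 i).
Proof.
elim: n v => [|n IH] v.
  move=> cv x.
  apply: (@continuous_comp _ _ _ v (fun M : 'rV[R]_3 => M 0 i)); first exact: cv.
  exact: (@coord_continuous R 1 3 0 i).
move=> [dv Dv]; split=> [x|u].
  apply: (@differentiable_comp _ _ _ _ v (fun M : 'rV[R]_3 => M 0 i)) => //.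
  exact: differentiable_coord.
have -> : 'D_u (fun x => v x 0 i) = fun x => ('D_u v x) 0 i.
  by apply/funext => x; rewrite derive_mx ?mxE //; exact: diff_derivable.
exact: IH (Dv u).
Qed.

Lemma Cn_dot n (d : 'rV[R]_3) (v : 'rV[R]_3 -> 'rV[R]_3) :
  Cn n v -> Cn n (fun x => dot d (v x)).
Proof.
move=> Cv.
have -> : (fun x => dot d (v x)) = d 0 0 \*: (fun x => v x 0 0) +
    d 0 1 \*: (fun x => v x 0 1) + d 0 2 \*: (fun x => v x 0 2).
  by apply/funext => x; rewrite dotE.
by do !apply: CnD; apply: CnZ; exact: Cn_coord.
Qed.

End TameFunctions.

(** * Integrals over lines *)

Section LineIntegrals.
Context {R : realType}.
Notation mu := (@lebesgue_measure R).
Implicit Types (f g : 'rV[R]_3 -> R) (e u w x y : 'rV[R]_3).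

(** The bound [N] is uniform over bounded base points and over directions
    bounded away from zero, which is needed to differentiate under the integral sign. *)
Lemma line_leaves_ball r B eps : 0 < eps ->
  exists2 N, 0 <= N & forall x e s,
    `|x| <= B -> eps <= `|e| -> N < `|s| -> r < `|x + s *: e|.
Proof.
move=> eps0; exists ((`|r| + `|B|) / eps).
  by rewrite divr_ge0 ?addr_ge0 // ltW.
move=> x e s xB ee; rewrite ltr_pdivrMr // => Ns.
have : `|s| * eps <= `|s *: e| by rewrite normrZ ler_wpM2l.
have : `|s *: e| <= `|x + s *: e| + `|x|.
  by rewrite -{1}(addrK x (s *: e)) (addrC (s *: e)) ler_normB.
by have := ler_norm r; have := ler_norm B; lra.
Qed.

(** The X-ray transform. The direction [e] need not be a unit vector: [xray] is
    positively homogeneous of degree -1 in it, see [xray_dilate]. *)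
Definition xray f x e : R := \int[mu]_s f (x + s *: e).

Lemma line_continuous f x e : continuous f -> continuous (fun s : R => f (x + s *: e)).
Proof.
move=> cf s; apply: (@continuous_comp _ _ _ (fun s : R => x + s *: e) f); last exact: cf.
exact: (is_derive_continuous (fun s : R => is_derive_affine x e s)).
Qed.

Lemma tame_line n f x e : e != 0 -> tame n f ->
  exists N, vanishes_beyond N (fun s => f (x + s *: e)).
Proof.
move=> e0 [_ [r f0]]; have ep : 0 < `|e| by rewrite normr_gt0.
have [N _ HN] := line_leaves_ball r `|x| ep.
by exists N => s Ns; apply: f0; exact: HN.
Qed.

Lemma integrable_line n f x e : e != 0 -> tame n f ->
  mu.-integrable setT (EFin \o (fun s => f (x + s *: e))).
Proof.
move=> e0 tf; have [N fN] := tame_line x e0 tf.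
apply: (integrable_compact_support measurableT _ fN).
exact: line_continuous (tame_cont tf).
Qed.

Lemma xray_add n f g x e : e != 0 -> tame n f -> tame n g ->
  xray (f + g) x e = xray f x e + xray g x e.
Proof.
by move=> e0 tf tg; rewrite -RintegralD //; apply: (@integrable_line n).
Qed.

Lemma xray_scale n k f x e : e != 0 -> tame n f -> xray (k \*: f) x e = k * xray f x e.
Proof. by move=> e0 tf; rewrite -RintegralZl //; apply: (@integrable_line n). Qed.

Lemma xray_bounded n f e B : e != 0 -> tame n f ->
  exists2 C, 0 <= C & forall y, `|y| <= B -> `|xray f y e| <= C.
Proof.
move=> e0 tf; have ep : 0 < `|e| by rewrite normr_gt0.
have [M M0 fM] := tame_bounded tf; have [_ [r f0]] := tf.
have [N N0 HN] := line_leaves_ball r B ep.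
exists (M * (N + N)) => [|y yB]; first by rewrite mulr_ge0 ?addr_ge0.
apply: Rintegral_bounded => //; first exact: line_continuous (tame_cont tf).
by move=> s Ns; apply: f0; exact: HN.
Qed.

(** A line that moves at an affine speed: the point of abscissa [s] has velocity
    [w + s *: u]. *)
Lemma xray_derive n f x w e u (k0 : R) : e + k0 *: u != 0 -> tame n.+1 f ->
  is_derive k0 1 (fun k => xray f (x + k *: w) (e + k *: u))
    (\int[mu]_s 'D_(w + s *: u) f (x + k0 *: w + s *: (e + k0 *: u))).
Proof.
move=> e0 tf; have [_ [r f0]] := tf.
(* Near [k0] the direction keeps at least half of its norm. *)
pose eps := `|e + k0 *: u| / 2.
have ep : 0 < `|e + k0 *: u| by rewrite normr_gt0.
have eps0 : 0 < eps by rewrite divr_gt0.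
have u0 := normr_ge0 u.
pose dl := eps / (`|u| + 1).
have u1 : 0 < `|u| + 1 by lra.
have dl0 : 0 < dl by rewrite divr_gt0.
have dlE : dl * (`|u| + 1) = eps by rewrite divfK // gt_eqF.
pose B := `|x| + (`|k0| + dl) * `|w|.
have [N N0 HN] := line_leaves_ball r B eps0.
have [Mw Mw0 HMw] := tame_bounded (tame_derive w tf).
have [Mu Mu0 HMu] := tame_bounded (tame_derive u tf).
have near_e (k : R) : `|k - k0| < dl -> eps <= `|e + k *: u|.
  move=> kd.
  have : `|e + k0 *: u| <= `|e + k *: u| + `|(k - k0) *: u|.
    rewrite (le_trans _ (ler_normB _ _)) // scalerBl opprB.
    by rewrite addrACA subrr addr0 // addrC.
  have : `|(k - k0) *: u| <= eps.
    rewrite normrZ -dlE; apply: ler_pM => //; first exact: ltW.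
    by lra.
  by rewrite /eps; lra.
have near_x (k : R) : `|k - k0| < dl -> `|x + k *: w| <= B.
  move=> kd; rewrite (le_trans (ler_normD _ _)) // lerD2l normrZ ler_wpM2r //.
  have : `|k| <= `|k0| + `|k - k0| by rewrite -{1}(subrKC k0 k) ler_normD.
  by lra.
pose F' (k s : R) := 'D_(w + s *: u) f (x + k *: w + s *: (e + k *: u)).
apply: (@derive_Rintegral_param _ setT
  (fun k s => f (x + k *: w + s *: (e + k *: u))) F' k0 dl N (Mw + N * Mu)) => //.
- by move=> k kd; exact: line_continuous (tame_cont tf).
- by move=> k kd s Ns; apply: f0; apply: HN => //; [exact: near_x|exact: near_e].
- move=> k s kd _.
  apply: (@is_derive_curve _ _ _ f (fun k => x + k *: w + s *: (e + k *: u))).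
    exact: tame_diff tf.
  have -> : (fun k => x + k *: w + s *: (e + k *: u)) =
            (fun k => (x + s *: e) + k *: (w + s *: u)).
    apply/funext => k'; rewrite !scalerDr !scalerA (mulrC k') addrACA //.
  exact: is_derive_affine.
- move=> k s kd _ sN; rewrite /F' deriveDdir ?deriveZdir; try exact: tame_diff tf.
  rewrite (le_trans (ler_normD _ _)) // lerD // normrZ.
  by apply: ler_pM.
Qed.

Lemma xray_derive_pt n f x w e (k0 : R) : e != 0 -> tame n.+1 f ->
  is_derive k0 1 (fun k => xray f (x + k *: w) e) (xray ('D_w f) (x + k0 *: w) e).
Proof.
move=> e0 tf; have := @xray_derive n f x w e 0 k0.
rewrite scaler0 addr0 => /(_ e0 tf).
have -> : (fun k => xray f (x + k *: w) (e + k *: 0)) = (fun k => xray f (x + k *: w) e).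
  by apply/funext => k; rewrite scaler0 addr0.
by rewrite /xray; under eq_Rintegral do rewrite scaler0 addr0.
Qed.

(** The abscissa weight comes from turning the direction of the line. *)
Definition xray_moment f x e : R := \int[mu]_s (s * f (x + s *: e)).

Lemma xray_derive_dir n f x e u (k0 : R) : e + k0 *: u != 0 -> tame n.+1 f ->
  is_derive k0 1 (fun k => xray f x (e + k *: u)) (xray_moment ('D_u f) x (e + k0 *: u)).
Proof.
move=> e0 tf; have := @xray_derive n f x 0 e u k0 e0 tf.
have -> : (fun k => xray f (x + k *: 0) (e + k *: u)) = (fun k => xray f x (e + k *: u)).
  by apply/funext => k; rewrite scaler0 addr0.
rewrite /xray_moment; under eq_Rintegral => s _.
  rewrite add0r scaler0 addr0 deriveZdir; last exact: tame_diff tf.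
over.
by [].
Qed.

Lemma is_derive_line n f x e (s : R) : tame n.+1 f ->
  is_derive s 1 (fun s => f (x + s *: e)) ('D_e f (x + s *: e)).
Proof.
move=> tf; apply: (@is_derive_curve _ _ _ f (fun s => x + s *: e)).
  exact: tame_diff tf.
exact: is_derive_affine.
Qed.

Lemma xray_derive_along n f x e : e != 0 -> tame n.+1 f -> xray ('D_e f) x e = 0.
Proof.
move=> e0 tf.
have [N f0] := tame_line x e0 tf.
have [N' f'0] := tame_line x e0 (tame_derive e tf).
have [g0 g'0] := vanishes_beyond_max f0 f'0.
apply: (Rintegral_derive_line (fun s => is_derive_line x e s tf) _ g0 g'0).
exact: line_continuous (tame_cont (tame_derive e tf)).
Qed.

Lemma integrable_moment n f x e : e != 0 -> tame n f ->
  mu.-integrable setT (EFin \o (fun s => s * f (x + s *: e))).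
Proof.
move=> e0 tf; have [N f0] := tame_line x e0 tf.
apply: (@integrable_compact_support _ _ N) => //; last first.
  by move=> s /f0 ->; rewrite mulr0.
move=> s; apply: (@continuousM _ _ id (fun s : R => f (x + s *: e)) s).
  exact: cvg_id.
exact: line_continuous (tame_cont tf) _.
Qed.

Lemma xray_moment_add n f g x e : e != 0 -> tame n f -> tame n g ->
  xray_moment (f + g) x e = xray_moment f x e + xray_moment g x e.
Proof.
move=> e0 tf tg; rewrite -RintegralD //; try exact: (@integrable_moment n).
by apply: eq_Rintegral => s _; rewrite -mulrDr.
Qed.

Lemma xray_moment_scale n k f x e : e != 0 -> tame n f ->
  xray_moment (k \*: f) x e = k * xray_moment f x e.
Proof.
move=> e0 tf; rewrite -RintegralZl //; last exact: (@integrable_moment n).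
by apply: eq_Rintegral => s _; rewrite mulrCA.
Qed.

(** Integration by parts along the line: the derivative of [s * f] is
    [s * 'D_e f + f]. *)
Lemma xray_moment_derive_along n f x e : e != 0 -> tame n.+1 f ->
  xray_moment ('D_e f) x e = - xray f x e.
Proof.
move=> e0 tf; have tf' := tame_derive e tf.
have [N f0] := tame_line x e0 tf.
have [N' f'0] := tame_line x e0 tf'.
have [g0 g'0] := vanishes_beyond_max f0 f'0.
apply/eqP; rewrite -addr_eq0 -RintegralD //;
  try by [exact: integrable_moment tf'|exact: integrable_line tf].
apply/eqP; apply: (@Rintegral_derive_line _ (Num.max N N') (fun s => s * f (x + s *: e))).
- move=> s; have := is_deriveM (is_derive_id s 1) (is_derive_line x e s tf).
  rewrite /= !scaler1 addrC.
  by rewrite addrC.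
- move=> s; apply: (@continuousD _ _ _ (fun s : R => s * 'D_e f (x + s *: e))
    (fun s : R => f (x + s *: e))); last exact: line_continuous (tame_cont tf) _.
  apply: (@continuousM _ _ id (fun s : R => 'D_e f (x + s *: e)) s).
    exact: cvg_id.
  exact: line_continuous (tame_cont tf') _.
- by move=> s /g0 ->; rewrite mulr0.
- by move=> s Ns; rewrite g'0 // g0 // mulr0 addr0.
Qed.

(** This change of variables and the next one are proved by differentiating along
    the family of substitutions: the result is the integral over the line of an
    exact derivative, hence zero. *)
Lemma xray_shift n f x e k : e != 0 -> tame n.+1 f -> xray f (x + k *: e) e = xray f x e.
Proof.
move=> e0 tf.
have := @eq_of_derive0 R (fun l => xray f (x + l *: (k *: e)) e).
rewrite scale1r scale0r addr0; apply => l _.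
have := xray_derive_pt x (k *: e) l e0 tf.
rewrite (derive_scaledir _ _ tf) (xray_scale _ _ e0 (tame_derive e tf)).
by rewrite (xray_derive_along _ e0 tf) mulr0.
Qed.

Lemma xray_dilate n f x e c : 0 < c -> e != 0 -> tame n.+1 f ->
  c * xray f x (c *: e) = xray f x e.
Proof.
move=> c0 e0 tf.
(* The factor [k l] runs from 1 to [c] along a segment of positive numbers. *)
pose k l := 1 + l * (c - 1).
have := @eq_of_derive0 R (fun l => k l * xray f x (e + l *: ((c - 1) *: e))).
have kE l : e + l *: ((c - 1) *: e) = k l *: e by rewrite scalerA scalerDl scale1r.
rewrite !kE /k mul1r subrKC mul0r addr0 mul1r scale1r; apply=> l l01.
have kl : 0 < k l by rewrite /k; nra.
have kle : k l *: e != 0 by rewrite scaler_eq0 negb_or gt_eqF.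
have dk : is_derive l 1 k (c - 1).
  have -> : k = (fun l => 1 + l *: (c - 1)) by [].
  exact: is_derive_affine.
have dJ : is_derive l 1 (fun l => xray f x (e + l *: ((c - 1) *: e)))
    ((c - 1) * xray_moment ('D_e f) x (k l *: e)).
  have := @xray_derive_dir n f x e ((c - 1) *: e) l; rewrite kE => /(_ kle tf).
  by rewrite (derive_scaledir _ _ tf) (xray_moment_scale _ _ kle (tame_derive e tf)).
have := is_deriveM dk dJ; rewrite kE /=.
suff -> : k l *: ((c - 1) * xray_moment ('D_e f) x (k l *: e))
    + xray f x (k l *: e) *: (c - 1) = 0 by [].
have := xray_moment_derive_along x kle tf.
rewrite (derive_scaledir _ _ tf) (xray_moment_scale _ _ kle (tame_derive e tf)).
rewrite -[k l *: (_ * _)]/(k l * (_ * _)) -[_ *: (c - 1)]/(_ * (c - 1)) => H.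
by rewrite mulrCA H; ring.
Qed.

End LineIntegrals.

(** * Integrals over half-planes *)

Section RayIntegrals.
Context {R : realType}.
Notation mu := (@lebesgue_measure R).
Implicit Types (f g : 'rV[R]_3 -> R) (e u w x y nu eta : 'rV[R]_3).

Lemma coord_le_norm x (i : 'I_3) : `|x 0 i| <= `|x|.
Proof.
rewrite [X in _ <= X]/Num.norm /= mx_normrE.
exact: (le_bigmax _ (fun ij : 'I_1 * 'I_3 => `|x ij.1 ij.2|) (0, i)).
Qed.

Lemma dot_le_norm u x : `|dot u x| <= 3 * `|u| * `|x|.
Proof.
have H i : `|u 0 i * x 0 i| <= `|u| * `|x|.
  by rewrite normrM ler_pM // coord_le_norm.
rewrite dotE (le_trans (ler_normD _ _)) //.
have := ler_normD (u 0 0 * x 0 0) (u 0 1 * x 0 1).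
have := H 0; have := H 1; have := H 2; lra.
Qed.

(** The linear form [dot eta] is constant along [e] and sees only the abscissa
    [t], which therefore bounds the norm from below, uniformly in [s]. *)
Lemma plane_leaves_ball r B eps eta : 0 < eps ->
  exists2 N, 0 <= N & forall x nu e t s,
    `|x| <= B -> dot eta e = 0 -> eps <= dot eta nu -> N < `|t| ->
    r < `|x + t *: nu + s *: e|.
Proof.
move=> eps0; pose C := 3 * `|eta|.
have C0 : 0 <= C by rewrite mulr_ge0.
exists ((C * (`|r| + `|B|)) / eps).
  by rewrite divr_ge0 ?mulr_ge0 ?addr_ge0 // ltW.
move=> x nu e t s xB etae etanu; rewrite ltr_pdivrMr // => Nt.
rewrite ltNge; apply/negP => yr.
set y := x + _ + _ in yr.
have E : t * dot eta nu = dot eta y - dot eta x.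
  rewrite /y (dotC eta (_ + _)) !dotDl !dotZl (dotC e) etae (dotC nu) (dotC x).
  by ring.
have h1 : `|t| * eps <= `|t * dot eta nu|.
  by rewrite normrM ler_wpM2l // (le_trans etanu) // ler_norm.
have h2 : `|dot eta y| <= C * `|r|.
  by rewrite (le_trans (dot_le_norm _ _)) // ler_wpM2l // (le_trans yr) // ler_norm.
have h3 : `|dot eta x| <= C * `|B|.
  by rewrite (le_trans (dot_le_norm _ _)) // ler_wpM2l // (le_trans xB) // ler_norm.
have := ler_normB (dot eta y) (dot eta x).
rewrite -E mulrDr in Nt *; lra.
Qed.

Lemma xray_ray_vanishes n f eta B eps : 0 < eps -> tame n f ->
  exists2 N, 0 <= N & forall x nu e, `|x| <= B -> dot eta e = 0 ->
    eps <= dot eta nu -> vanishes_beyond N (fun t => xray f (x + t *: nu) e).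
Proof.
move=> eps0 [_ [r f0]].
have [N N0 HN] := plane_leaves_ball r B eta eps0.
exists N => // x nu e xB etae etanu t Nt; rewrite /xray.
under eq_Rintegral => s _ do rewrite f0 ?HN //.
by rewrite Rintegral_cst //= mul0r.
Qed.

(** Not parallel, with a linear form that witnesses it: the form is what the
    estimates use. *)
Definition transverse e nu := e != 0 /\ exists2 eta, dot eta e = 0 & 0 < dot eta nu.

(** The integral over the half-plane spanned by [e] and the ray in direction
    [nu], taken first along [e]. *)
Definition ray_xray f x e nu : R := \int[mu]_(t in `[0, +oo[) xray f (x + t *: nu) e.

Lemma xray_ray_continuous n f x e nu : e != 0 -> tame n.+1 f ->
  continuous (fun t : R => xray f (x + t *: nu) e).
Proof.
move=> e0 tf.
exact: (is_derive_continuous (fun t : R => xray_derive_pt x nu t e0 tf)).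
Qed.

(** Moving the origin along the ray removes an initial piece of the ray. The
    derivative falls on the integrand as a derivative in [t], and the
    fundamental theorem of calculus leaves the value at the origin. *)
Lemma ray_xray_derive_along n f x e nu (h : R) : transverse e nu -> tame n.+2 f ->
  is_derive h 1 (fun h => ray_xray f (x + h *: nu) e nu) (- xray f (x + h *: nu) e).
Proof.
move=> [e0 [eta etae etanu]] tf; have tf' := tame_derive nu tf.
pose B := `|x| + (`|h| + 1) * `|nu|.
have [N N0 HN] := xray_ray_vanishes eta B etanu tf.
have [N' N'0 HN'] := xray_ray_vanishes eta B etanu tf'.
have [C C0 HC] := xray_bounded (B + N * `|nu|) e0 tf'.
have xB (k : R) : `|k - h| < 1 -> `|x + k *: nu| <= B.
  move=> kh; rewrite (le_trans (ler_normD _ _)) // lerD2l normrZ ler_wpM2r //.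
  have : `|k| <= `|h| + `|k - h| by rewrite -{1}(subrKC h k) ler_normD.
  by lra.
have xhB : `|x + h *: nu| <= B by apply: xB; rewrite subrr normr0.
have swap (k t : R) : x + k *: nu + t *: nu = x + t *: nu + k *: nu by rewrite addrAC.
pose F' (k t : R) := xray ('D_nu f) (x + k *: nu + t *: nu) e.
have -> : - xray f (x + h *: nu) e = \int[mu]_(t in `[0, +oo[) F' h t.
  have [g0 g'0] := vanishes_beyond_max (HN _ _ _ xhB etae (lexx _))
    (HN' _ _ _ xhB etae (lexx _)).
  rewrite (Rintegral_derive_ray (fun t : R => xray_derive_pt (x + h *: nu) nu t e0 tf) _ g0 g'0).
    by rewrite scale0r addr0.
  exact: xray_ray_continuous tf'.
apply: (@derive_Rintegral_param _ _ (fun k t => xray f (x + k *: nu + t *: nu) e) F' h 1 N C) => //.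
- by move=> k _; exact: xray_ray_continuous tf.
- by move=> k kh; apply: HN => //; exact: xB.
- move=> k t _ _; rewrite /F' swap.
  have -> : (fun k : R => xray f (x + k *: nu + t *: nu) e) =
            (fun k : R => xray f (x + t *: nu + k *: nu) e).
    by apply/funext => k'; rewrite swap.
  exact: xray_derive_pt tf.
- move=> k t kh _ tN; apply: HC.
  rewrite (le_trans (ler_normD _ _)) // lerD ?xB // normrZ ler_wpM2r //.
Qed.

End RayIntegrals.

(** * Cross products and orthonormal frames *)

Section Frames.
Context {R : realType}.
Implicit Types (n u w nu : 'rV[R]_3).

Lemma vec_basis u : u = u 0 0 *: Defs.basis 0 + u 0 1 *: Defs.basis 1 + u 0 2 *: Defs.basis 2.
Proof.
apply/rowP => i; rewrite /Defs.basis !mxE.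
case: i => [[|[|[|//]]] hi] /=; rewrite ?mulr1 ?mulr0 ?addr0 ?add0r;
  by congr (u 0 _); apply: val_inj.
Qed.

Lemma vec3_basis (y0 y1 y2 : R) :
  vec3 y0 y1 y2 = y0 *: Defs.basis 0 + y1 *: Defs.basis 1 + y2 *: Defs.basis 2.
Proof. by rewrite [LHS]vec_basis !vec3E. Qed.

Lemma dot_basis i u : dot (Defs.basis i) u = u 0 i.
Proof. by rewrite dot_mxE -rowE !mxE. Qed.

Lemma derive_basis f u x : differentiable f x ->
  'D_u f x = u 0 0 * 'D_(Defs.basis 0) f x + u 0 1 * 'D_(Defs.basis 1) f x
           + u 0 2 * 'D_(Defs.basis 2) f x :> R.
Proof. by move=> df; rewrite {1}(vec_basis u) !deriveDdir // !deriveZdir. Qed.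

Definition cross (u w : 'rV[R]_3) : 'rV[R]_3 :=
  vec3 (u 0 1 * w 0 2 - u 0 2 * w 0 1) (u 0 2 * w 0 0 - u 0 0 * w 0 2)
       (u 0 0 * w 0 1 - u 0 1 * w 0 0).

Lemma crossDr k u w w' : cross u (w + k *: w') = cross u w + k *: cross u w'.
Proof.
by rewrite /cross scale_vec3 add_vec3 !mxE; congr vec3; ring.
Qed.

Lemma crossC u w : cross u w = - cross w u.
Proof.
by rewrite -scaleN1r /cross scale_vec3; congr vec3; ring.
Qed.

Lemma crossNr u w : cross u (- w) = - cross u w.
Proof.
rewrite -(scaleN1r (cross u w)) [LHS]/cross [in RHS]/cross scale_vec3 !mxE.
by congr vec3; ring.
Qed.

Lemma det_rows3_cross u w n : \det (rows3 u w n) = dot n (cross u w).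
Proof.
rewrite [u in RHS]vec3_eta (vec3_eta u) (vec3_eta w) (vec3_eta n) det_rows3.
by rewrite dotE /cross !vec3E; ring.
Qed.

(** The determinant of the Gram matrix of three vectors is the square of their
    mixed product. *)
Lemma gram u w n : dot n (cross u w) ^+ 2 =
  dot n n * dot u u * dot w w + 2 * (dot n u * dot u w * dot n w)
  - dot n n * dot u w ^+ 2 - dot u u * dot n w ^+ 2 - dot w w * dot n u ^+ 2.
Proof. by rewrite !dotE /cross !vec3E; ring. Qed.

Lemma dot_cross_cross u w :
  dot (cross u w) (cross u w) = dot u u * dot w w - dot u w ^+ 2.
Proof. by rewrite !dotE /cross !vec3E; ring. Qed.

Lemma dot_cross_l u w : dot u (cross u w) = 0.
Proof. by rewrite dotE /cross !vec3E; ring. Qed.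

Lemma dot_cross_r u w : dot w (cross u w) = 0.
Proof. by rewrite dotE /cross !vec3E; ring. Qed.

Lemma dotBB u w : dot (u - w) (u - w) = dot u u - 2 * dot u w + dot w w.
Proof. by rewrite !dotE !mxE; ring. Qed.

Lemma dot_self_eq0 u : dot u u = 0 -> u = 0.
Proof.
rewrite dotE -!expr2 => /eqP; rewrite !paddr_eq0 ?addr_ge0 ?sqr_ge0 //.
rewrite !sqrf_eq0 => /andP[/andP[/eqP u0 /eqP u1] /eqP u2].
rewrite (vec3_eta u) u0 u1 u2; apply/rowP => i; rewrite !mxE.
by case: i => [[|[|[|]]]].
Qed.

Lemma unit_neq0 u : dot u u = 1 -> u != 0.
Proof.
move=> u1; apply/eqP => u0; move: u1; rewrite u0 dotE !mxE !mulr0 !addr0 => /eqP.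
by rewrite eq_sym oner_eq0.
Qed.

Definition orthonormal2 u w := [/\ dot u u = 1, dot w w = 1 & dot u w = 0].

(** By [gram] the mixed product of the three vectors has square 1, and the
    orientation makes it 1; then [n - cross u w] has norm zero. *)
Lemma oriented_frame_cross u w n : orthonormal2 u w ->
  dot n n = 1 -> dot n u = 0 -> dot n w = 0 -> positively_oriented u w n ->
  n = cross u w.
Proof.
move=> [uu ww uw] nn nu nw; rewrite /positively_oriented det_rows3_cross => d0.
have := gram u w n; rewrite nn uu ww uw nu nw => d2.
have d1 : dot n (cross u w) = 1 by nra.
apply/eqP; rewrite -subr_eq0; apply/eqP/dot_self_eq0.
by rewrite dotBB nn d1 dot_cross_cross uu ww uw; ring.
Qed.

Lemma cross_cross_orthonormal u w : orthonormal2 u w -> cross u (cross u w) = - w.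
Proof.
move=> [uu _ uw].
have -> : cross u (cross u w) = dot u w *: u - dot u u *: w.
  by rewrite [RHS]vec3_eta /cross !vec3E; congr vec3; rewrite !mxE !dotE; ring.
by rewrite uw uu scale0r scale1r add0r.
Qed.

Lemma orthonormal2_turn u w : orthonormal2 u w -> orthonormal2 u (cross u w).
Proof.
move=> [uu ww uw]; split => //; last exact: dot_cross_l.
by rewrite dot_cross_cross uu ww uw; ring.
Qed.

(** Otherwise [nu] would be parallel to [u], and a form that vanishes on [u]
    would vanish on [nu]. *)
Lemma transverse_component u w nu : orthonormal2 u w -> transverse u nu ->
  dot w nu != 0 \/ dot (cross u w) nu != 0.
Proof.
move=> [uu ww uw] [_ [eta etau etanu]].
have [w0|] := eqVneq (dot w nu) 0; last by left.
have [n0|] := eqVneq (dot (cross u w) nu) 0; last by right.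
have := gram u w nu; rewrite !(dotC nu) w0 n0 uu ww uw => g.
have : dot (nu - dot u nu *: u) (nu - dot u nu *: u) = 0.
  by rewrite dotBB dotZr dotZl dotZr uu (dotC nu); lra.
move/dot_self_eq0/eqP; rewrite subr_eq0 => /eqP nuE.
by move: etanu; rewrite nuE dotZr etau mulr0 ltxx.
Qed.

End Frames.

(** * The momentum flux of a steady flow *)

Section EulerField.
Context {R : realType}.
Implicit Types (a b c d n u x : 'rV[R]_3).
Variables (v : 'rV[R]_3 -> 'rV[R]_3) (p : 'rV[R]_3 -> R).

(** The component of the momentum flux tensor v (x) v along two directions. *)
Definition stress d n : 'rV[R]_3 -> R := fun x => dot d (v x) * dot n (v x).

Lemma stressE d n y : stress d n y = dot d (v y) * dot n (v y).
Proof. by []. Qed.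

Lemma stress_sym d n : stress d n = stress n d.
Proof. by apply/funext => x; rewrite /stress mulrC. Qed.

Lemma stress_lin k d d' n : stress (d + k *: d') n = stress d n + k \*: stress d' n.
Proof.
by apply/funext => x; rewrite /stress dotDl dotZl
  -[RHS]/(stress d n x + k * stress d' n x) /stress; ring.
Qed.

Lemma stress_Zl k d n : stress (k *: d) n = k \*: stress d n.
Proof.
by apply/funext => x; rewrite /stress dotZl -[RHS]/(k * stress d n x) /stress; ring.
Qed.

Hypothesis hv : smooth_compact_support v.
Hypothesis hp : smooth_compact_support p.
Hypothesis heuler : steady_euler v p.

Lemma tame_p k : tame k p.
Proof.
by have [sp /vanishes_outside_ball vp] := hp; split => //; exact: smooth_Cn.
Qed.

Lemma tame_stress k d n : tame k (stress d n).
Proof.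
have [sv /vanishes_outside_ball[r v0]] := hv.
have Cd d' : Cn k (fun x => dot d' (v x)) by exact/Cn_dot/smooth_Cn.
split; first exact: (CnM (Cd d) (Cd n)).
exists r => x rx; rewrite /stress v0 // (_ : dot d 0 = 0) ?mul0r //.
by rewrite dotE !mxE !mulr0 !addr0.
Qed.

Let vv (i j : 'I_3) : 'rV[R]_3 -> R := fun x => v x 0 i * v x 0 j.

Lemma vvE i j : vv i j = stress (Defs.basis i) (Defs.basis j).
Proof. by apply/funext => x; rewrite /stress !dot_basis. Qed.

Lemma tame_vv k i j : tame k (vv i j).
Proof. by rewrite vvE; exact: tame_stress. Qed.

Lemma derive_stress d n u x : 'D_u (stress d n) x =
  d 0 0 * n 0 0 * 'D_u (vv 0 0) x + (d 0 0 * n 0 1 + d 0 1 * n 0 0) * 'D_u (vv 0 1) x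
  + (d 0 0 * n 0 2 + d 0 2 * n 0 0) * 'D_u (vv 0 2) x + d 0 1 * n 0 1 * 'D_u (vv 1 1) x
  + (d 0 1 * n 0 2 + d 0 2 * n 0 1) * 'D_u (vv 1 2) x + d 0 2 * n 0 2 * 'D_u (vv 2 2) x.
Proof.
have dt i j : derivable (vv i j) x u.
  by apply: diff_derivable; exact: (tame_diff _ (tame_vv 1 i j)).
have -> : stress d n = (d 0 0 * n 0 0) \*: vv 0 0 + (d 0 0 * n 0 1 + d 0 1 * n 0 0) \*: vv 0 1
  + (d 0 0 * n 0 2 + d 0 2 * n 0 0) \*: vv 0 2 + (d 0 1 * n 0 1) \*: vv 1 1
  + (d 0 1 * n 0 2 + d 0 2 * n 0 1) \*: vv 1 2 + (d 0 2 * n 0 2) \*: vv 2 2.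
  apply/funext => y; rewrite /stress !dotE !fctE !scalefE /vv; ring.
have dZ k i j : is_derive x u (k \*: vv i j) (k * 'D_u (vv i j) x).
  by apply: is_deriveZ; exact: derivableP.
exact: (@derive_val _ _ _ _ _ _ _ (is_deriveD (is_deriveD (is_deriveD (is_deriveD
  (is_deriveD (dZ _ 0 0) (dZ _ 0 1)) (dZ _ 0 2)) (dZ _ 1 1)) (dZ _ 1 2)) (dZ _ 2 2))).
Qed.

Lemma euler_basis i x :
  'D_(Defs.basis i) p x = - ('D_(Defs.basis 0) (vv i 0) x + 'D_(Defs.basis 1) (vv i 1) x
                        + 'D_(Defs.basis 2) (vv i 2) x).
Proof.
have e1 : lift ord0 ord0 = 1 :> 'I_3 by exact: val_inj.
have e2 : lift ord0 (lift ord0 ord0) = 2 :> 'I_3 by exact: val_inj.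
have := heuler i x; rewrite !big_ord_recl big_ord0 addr0 addrA e1 e2 => /eqP.
by rewrite addr_eq0 => /eqP H; rewrite -[LHS]opprK -H.
Qed.

(** The vectors [cross b c], [cross c a], [cross a b] are the dual basis of
    [a], [b], [c] up to the factor [dot a (cross b c)], so the left-hand side is
    that factor times the divergence of the field [stress d]. *)
Lemma divergence_frame d a b c x :
  'D_a (stress d (cross b c)) x + 'D_b (stress d (cross c a)) x + 'D_c (stress d (cross a b)) x
  = - dot a (cross b c) * 'D_d p x.
Proof.
have dp : differentiable p x := tame_diff x (tame_p 1).
have dt i j : differentiable (vv i j) x := tame_diff x (tame_vv 1 i j).
have tC i j : vv i j = vv j i by apply/funext => y; rewrite /vv mulrC.
rewrite !derive_stress (derive_basis d dp) !euler_basis.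
rewrite (tC 1 0) (tC 2 0) (tC 2 1).
rewrite !(derive_basis a (dt _ _)) !(derive_basis b (dt _ _)) !(derive_basis c (dt _ _)).
rewrite dotE !vec3E.
(* With the Euler equations substituted, the identity is polynomial in the
   partial derivatives and in the coordinates of the vectors. *)
move: ('D_(Defs.basis 0) (vv 0 0) x) ('D_(Defs.basis 1) (vv 0 0) x) ('D_(Defs.basis 2) (vv 0 0) x).
move: ('D_(Defs.basis 0) (vv 0 1) x) ('D_(Defs.basis 1) (vv 0 1) x) ('D_(Defs.basis 2) (vv 0 1) x).
move: ('D_(Defs.basis 0) (vv 0 2) x) ('D_(Defs.basis 1) (vv 0 2) x) ('D_(Defs.basis 2) (vv 0 2) x).
move: ('D_(Defs.basis 0) (vv 1 1) x) ('D_(Defs.basis 1) (vv 1 1) x) ('D_(Defs.basis 2) (vv 1 1) x).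
move: ('D_(Defs.basis 0) (vv 1 2) x) ('D_(Defs.basis 1) (vv 1 2) x) ('D_(Defs.basis 2) (vv 1 2) x).
move: ('D_(Defs.basis 0) (vv 2 2) x) ('D_(Defs.basis 1) (vv 2 2) x) ('D_(Defs.basis 2) (vv 2 2) x).
move=> *; ring.
Qed.

End EulerField.

Section HalfPlaneFlux.
Context {R : realType}.
Notation mu := (@lebesgue_measure R).
Implicit Types (d n u w x e nu eta : 'rV[R]_3).
Variables (v : 'rV[R]_3 -> 'rV[R]_3) (p : 'rV[R]_3 -> R).
Hypothesis hv : smooth_compact_support v.
Hypothesis hp : smooth_compact_support p.
Hypothesis heuler : steady_euler v p.

(** Closedness of the 1-form nu |-> X T(e, e x nu): by [divergence_frame] the
    difference of the two integrands is a derivative along [e]. *)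
Lemma xray_stress_swap x e xi nu : e != 0 ->
  xray ('D_xi (stress v e (cross e nu))) x e = xray ('D_nu (stress v e (cross e xi))) x e.
Proof.
move=> e0; have tT k d n : tame k (stress v d n) := tame_stress hv k d n.
pose g := stress v e (cross nu xi) + dot xi (cross e nu) \*: p.
have tg k : tame k g by apply: tameD => //; apply: tameZ; exact: tame_p.
have -> : 'D_xi (stress v e (cross e nu)) = 'D_nu (stress v e (cross e xi)) + (-1) \*: 'D_e g.
  apply/funext => y; rewrite !fctE scalefE.
  have -> : 'D_e g y = 'D_e (stress v e (cross nu xi)) y + dot xi (cross e nu) * 'D_e p y.
    exact: (congr1 (fun F => F y) (tame_derive_lin _ e (tT 1 _ _) (tame_p hp 1))).
  have := divergence_frame hv hp heuler e xi e nu y.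
  have -> : stress v e (cross xi e) = (-1) \*: stress v e (cross e xi).
    by rewrite crossC stress_sym -scaleN1r stress_Zl stress_sym.
  have -> : 'D_nu ((-1) \*: stress v e (cross e xi)) y = - 'D_nu (stress v e (cross e xi)) y.
    by rewrite deriveZ ?scaleN1r //; exact: (diff_derivable (tame_diff y (tT 1 _ _))).
  move: ('D_xi _ y) ('D_nu _ y) ('D_e _ y) ('D_e p y) => A B C D H.
  have -> : A = - dot xi (cross e nu) * D + B - C by rewrite -H; ring.
  by ring.
rewrite (xray_add _ e0 (tame_derive nu (tT 1 _ _)) (tameZ _ (tame_derive e (tg 1)))).
by rewrite (xray_scale _ _ e0 (tame_derive e (tg 1))) (xray_derive_along _ e0 (tg 1)) mulr0 addr0.
Qed.

(** The flux of [stress e] through the half-plane, where [cross e nu] carries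
    both the unit normal and the area of the parallelogram on [e] and [nu]; so
    [nu] need not be normalised nor perpendicular to [e]. *)
Definition flux x e nu : R := ray_xray (stress v e (cross e nu)) x e nu.

(** Along the segment from [nu0] to [nu1], let m = nu1 - nu0 and let nu_k be the
    current direction. The derivative of the integrand in the parameter is
    X T(e, e x m) + t X (D_m T(e, e x nu_k)) at x + t nu_k. By
    [xray_stress_swap] the last derivative may be replaced by the derivative of
    T(e, e x m) along nu_k, and the sum becomes the derivative of
    t X T(e, e x m) in t, whose integral over the ray is zero. The form
    [dot eta] keeps the whole segment away from the line of [e]. *)
Lemma flux_segment x e eta nu0 nu1 : e != 0 -> dot eta e = 0 ->
  0 < dot eta nu0 -> 0 < dot eta nu1 -> flux x e nu0 = flux x e nu1.
Proof.
move=> e0 etae a0 b0; have tT k d n : tame k (stress v d n) := tame_stress hv k d n.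
pose m := nu1 - nu0; pose nu_ (k : R) := nu0 + k *: m.
pose f0 := stress v e (cross e nu0); pose f1 := stress v e (cross e m).
have tf0 k : tame k f0 := tT k _ _; have tf1 k : tame k f1 := tT k _ _.
have fE k : stress v e (cross e (nu_ k)) = f0 + k \*: f1.
  by rewrite crossDr stress_sym stress_lin stress_sym (stress_sym v _ e).
have := @eq_of_derive0 R (fun k : R => flux x e (nu_ k)).
have -> : nu_ 1 = nu1 by rewrite /nu_ scale1r subrKC.
have -> : nu_ 0 = nu0 by rewrite /nu_ scale0r addr0.
move=> H; apply/esym; apply: H => k0 k001.
pose F (k t : R) := xray f0 (x + t *: nu_ k) e + k * xray f1 (x + t *: nu_ k) e.
pose F' (k t : R) := t * xray ('D_m f0) (x + t *: nu_ k) e +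
  (k * (t * xray ('D_m f1) (x + t *: nu_ k) e) + xray f1 (x + t *: nu_ k) e * 1).
have FE k t : xray (stress v e (cross e (nu_ k))) (x + t *: nu_ k) e = F k t.
  by rewrite fE (xray_add _ e0 (tf0 0%N) (tameZ _ (tf1 0%N))) (xray_scale _ _ e0 (tf1 0%N)).
pose al := dot eta nu0; pose be := dot eta nu1.
pose eps := Num.min al be / 2.
have eps0 : 0 < eps by rewrite divr_gt0 // lt_min a0.
have epsa : eps * 2 <= al by rewrite divfK // ge_min lexx.
have epsb : eps * 2 <= be by rewrite divfK // ge_min lexx orbT.
pose dl := eps / (al + be).
have ab0 : 0 < al + be by rewrite addr_gt0.
have dl0 : 0 < dl by rewrite divr_gt0.
have dlE : dl * (al + be) = eps by rewrite divfK // gt_eqF.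
(* At [k0] [dot eta (nu_ k)] is a convex combination of [al] and [be], hence
   at least [2 * eps]; on the neighbourhood it changes by at most
   [dl * (al + be) = eps]. *)
have etanu k : `|k - k0| < dl -> eps <= dot eta (nu_ k).
  rewrite ltr_norml => /andP[kd1 kd2].
  have -> : dot eta (nu_ k) = (1 - k) * al + k * be.
    by rewrite /nu_ /m (dotC eta) dotDl dotZl dotDl dotNl !(dotC _ eta) -/al -/be; ring.
  have : 0 <= k0 * (be - eps * 2) by rewrite mulr_ge0 ?subr_ge0 //; lra.
  have : 0 <= (1 - k0) * (al - eps * 2) by rewrite mulr_ge0 ?subr_ge0 //; lra.
  have : 0 <= (k - k0 + dl) * be by rewrite mulr_ge0 ?(ltW b0) //; lra.
  have : 0 <= (dl - (k - k0)) * al by rewrite mulr_ge0 ?(ltW a0) //; lra.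
  by rewrite mulrDr in dlE; lra.
have [N0 N00 HN0] := xray_ray_vanishes eta `|x| eps0 (tf0 0%N).
have [N1 N10 HN1] := xray_ray_vanishes eta `|x| eps0 (tf1 0%N).
pose N := Num.max N0 N1.
have N_ge0 : 0 <= N by rewrite le_max N00.
pose B := `|x| + N * (`|nu0| + (`|k0| + dl) * `|m|).
have [C0 C00 HC0] := xray_bounded B e0 (tame_derive m (tf0 1%N)).
have [C1 C10 HC1] := xray_bounded B e0 (tf1 0%N).
have [C2 C20 HC2] := xray_bounded B e0 (tame_derive m (tf1 1%N)).
have kB (k : R) : `|k - k0| < dl -> `|k| <= `|k0| + dl.
  move=> kd; have : `|k| <= `|k0| + `|k - k0| by rewrite -{1}(subrKC k0 k) ler_normD.
  by lra.
have vF k : `|k - k0| < dl -> vanishes_beyond N (F k).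
  move=> kd t; rewrite /N gt_max => /andP[t0 t1]; rewrite /F.
  rewrite (HN0 _ _ _ (lexx _) etae (etanu _ kd)) //.
  by rewrite (HN1 _ _ _ (lexx _) etae (etanu _ kd)) // mulr0 addr0.
(* The derivative at [k0] is the integral of an exact derivative in [t]. *)
have zero : \int[mu]_(t in `[0, +oo[) F' k0 t = 0.
  have k0d : `|k0 - k0| < dl by rewrite subrr normr0.
  have F'E t : F' k0 t =
      t * xray ('D_(nu_ k0) f1) (x + t *: nu_ k0) e + xray f1 (x + t *: nu_ k0) e * 1.
    rewrite -(xray_stress_swap _ _ _ e0) fE.
    rewrite (tame_derive_lin k0 m (tf0 1%N) (tf1 1%N)).
    rewrite (xray_add _ e0 (tame_derive m (tf0 1%N)) (tameZ _ (tame_derive m (tf1 1%N)))).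
    rewrite (xray_scale _ _ e0 (tame_derive m (tf1 1%N))) /F'.
    by rewrite mulrDr (mulrCA t) addrA.
  under eq_Rintegral do rewrite F'E.
  have [N2 N20 HN2] := xray_ray_vanishes eta `|x| eps0 (tame_derive (nu_ k0) (tf1 1%N)).
  have [g0 g'0] := vanishes_beyond_max (HN1 _ _ _ (lexx _) etae (etanu _ k0d))
    (HN2 _ _ _ (lexx _) etae (etanu _ k0d)).
  have dt (t : R) := is_deriveM (is_derive_id t 1)
    (xray_derive_pt x (nu_ k0) t e0 (tf1 1%N)).
  have -> : \int[mu]_(t in `[0, +oo[) (t * xray ('D_(nu_ k0) f1) (x + t *: nu_ k0) e
      + xray f1 (x + t *: nu_ k0) e * 1) = - (0 * xray f1 (x + 0 *: nu_ k0) e).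
    apply: (@Rintegral_derive_ray _ (Num.max N1 N2)
      (fun t : R => t * xray f1 (x + t *: nu_ k0) e)) => //.
    - move=> t; apply: (@continuousD _ _ _
        (fun t : R => t * xray ('D_(nu_ k0) f1) (x + t *: nu_ k0) e)
        (fun t : R => xray f1 (x + t *: nu_ k0) e * 1)).
        apply: (@continuousM _ _ id (fun t : R => xray ('D_(nu_ k0) f1) (x + t *: nu_ k0) e)).
          exact: cvg_id.
        exact: xray_ray_continuous e0 (tame_derive (nu_ k0) (tf1 2%N)) _.
      have -> : (fun t : R => xray f1 (x + t *: nu_ k0) e * 1) =
                (fun t : R => xray f1 (x + t *: nu_ k0) e) by apply/funext => s; rewrite mulr1.
      exact: xray_ray_continuous e0 (tf1 1%N) _.
    - by move=> t Nt; rewrite g0 // mulr0.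
    - by move=> t Nt; rewrite g0 // g'0 // mulr0 mul0r addr0.
  by rewrite mul0r oppr0.
rewrite -zero /flux /ray_xray.
have -> : (fun k : R => \int[mu]_(t in `[0, +oo[)
          xray (stress v e (cross e (nu_ k))) (x + t *: nu_ k) e)
        = (fun k : R => \int[mu]_(t in `[0, +oo[) F k t).
  by apply/funext => k; apply: eq_Rintegral => t _; rewrite FE.
apply: (@derive_Rintegral_param _ _ F F' k0 dl N
  (N * C0 + ((`|k0| + dl) * (N * C2) + C1))) => //.
- move=> k _ t.
  apply: (@continuousD _ _ _ (fun t : R => xray f0 (x + t *: nu_ k) e)
    (fun t : R => k * xray f1 (x + t *: nu_ k) e)).
    exact: xray_ray_continuous e0 (tf0 1%N) _.
  apply: (@continuousM _ _ (cst k) (fun t : R => xray f1 (x + t *: nu_ k) e)).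
    exact: cvg_cst.
  exact: xray_ray_continuous e0 (tf1 1%N) _.
- move=> k t kd _; have dk := is_derive_id k (1 : R).
  have yE k' : x + t *: nu_ k' = (x + t *: nu0) + k' *: (t *: m).
    by rewrite /nu_ scalerDr !scalerA (mulrC k') addrA.
  have dJ f : tame 1 f -> is_derive k 1 (fun k : R => xray f (x + t *: nu_ k) e)
      (t * xray ('D_m f) (x + t *: nu_ k) e).
    move=> tf; have := xray_derive_pt (x + t *: nu0) (t *: m) k e0 tf.
    rewrite -yE (derive_scaledir _ _ tf) (xray_scale _ _ e0 (tame_derive m tf)).
    have -> : (fun k : R => xray f (x + t *: nu0 + k *: (t *: m)) e) =
              (fun k : R => xray f (x + t *: nu_ k) e).
      by apply/funext => k'; rewrite yE.
    by [].
  exact: (is_deriveD (dJ _ (tf0 1%N)) (is_deriveM dk (dJ _ (tf1 1%N)))).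
- move=> k t kd _ tN.
  have yB : `|x + t *: nu_ k| <= B.
    rewrite (le_trans (ler_normD _ _)) // lerD2l normrZ ler_pM //.
    rewrite (le_trans (ler_normD _ _)) // lerD2l normrZ ler_wpM2r // kB //.
  rewrite /F' (le_trans (ler_normD _ _)) // lerD //.
    by rewrite normrM ler_pM // HC0.
  rewrite (le_trans (ler_normD _ _)) // lerD //; last by rewrite mulr1 HC1.
  rewrite normrM ler_pM ?kB // normrM ler_pM // HC2 //.
Qed.

End HalfPlaneFlux.

Section FluxIndependence.
Context {R : realType}.
Implicit Types (u w x e nu : 'rV[R]_3).
Variables (v : 'rV[R]_3 -> 'rV[R]_3) (p : 'rV[R]_3 -> R).
Hypothesis hv : smooth_compact_support v.
Hypothesis hp : smooth_compact_support p.
Hypothesis heuler : steady_euler v p.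

(** The form given by [w + cross u w] is positive on both directions, so the
    segment between them is admissible. *)
Lemma flux_quarter_turn x u w : orthonormal2 u w -> flux v x u w = flux v x u (cross u w).
Proof.
move=> ow; have [uu ww uw] := ow; have [_ nn un] := orthonormal2_turn ow.
apply: (flux_segment hv hp heuler (eta := w + cross u w) x (unit_neq0 uu)).
- by rewrite dotDl !(dotC _ u) uw un addr0.
- by rewrite dotDl ww (dotC _ w) dot_cross_r addr0 ltr01.
- by rewrite dotDl nn dot_cross_r add0r ltr01.
Qed.

(** A segment cannot join opposite directions; quarter turns can. *)
Lemma flux_turns x u w : orthonormal2 u w ->
  [/\ flux v x u w = flux v x u (cross u w), flux v x u w = flux v x u (- w)
    & flux v x u w = flux v x u (- cross u w)].
Proof.
move=> ow; have q1 := flux_quarter_turn x ow; have on := orthonormal2_turn ow.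
have q2 := flux_quarter_turn x on; rewrite (cross_cross_orthonormal ow) in q2.
have om : orthonormal2 u (- w).
  by rewrite -(cross_cross_orthonormal ow); exact: orthonormal2_turn.
have q3 := flux_quarter_turn x om.
rewrite crossNr in q3.
split; [exact: q1|exact: (etrans q1 q2)|exact: (etrans q1 (etrans q2 q3))].
Qed.

(** Some vector among [w], [cross u w] and their opposites has a positive
    component along [nu], and [flux_segment] joins it to [nu]. *)
Lemma flux_indep x u w nu : orthonormal2 u w -> transverse u nu ->
  flux v x u nu = flux v x u w.
Proof.
move=> ow tr; have [uu ww uw] := ow; have [_ nn un] := orthonormal2_turn ow.
have u0 := unit_neq0 uu; have [k1 k2 k3] := flux_turns x ow.
have seg eta : dot eta eta = 1 -> dot eta u = 0 -> 0 < dot eta nu ->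
    flux v x u nu = flux v x u eta.
  move=> ee eu enu; have ep : 0 < dot eta eta by rewrite ee ltr01.
  exact: (flux_segment hv hp heuler x u0 eu enu ep).
have NN eta : dot (- eta) (- eta) = dot eta eta.
  by rewrite dotNl dotC dotNl opprK.
have [] := transverse_component ow tr; rewrite neq_lt => /orP[].
- move=> lt0; apply: (etrans (seg (- w) _ _ _) (esym k2)).
  + by rewrite NN.
  + by rewrite dotNl dotC uw oppr0.
  + by rewrite dotNl oppr_gt0.
- by move=> gt0; apply: (seg w ww _ gt0); rewrite dotC.
- move=> lt0; apply: (etrans (seg (- cross u w) _ _ _) (esym k3)).
  + by rewrite NN.
  + by rewrite dotNl dotC un oppr0.
  + by rewrite dotNl oppr_gt0.
- by move=> gt0; apply: (etrans (seg (cross u w) nn _ gt0) (esym k1)); rewrite dotC.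
Qed.

Lemma flux_shift x e nu k : e != 0 -> flux v (x + k *: e) e nu = flux v x e nu.
Proof.
move=> e0; apply: eq_Rintegral => t _.
by rewrite addrAC (xray_shift _ _ e0 (tame_stress hv 1 _ _)).
Qed.

End FluxIndependence.

(** * The function w as an iterated integral *)

Section PlaneFubini.
Context {R : realType}.
Notation mu := (@lebesgue_measure R).

(** An open set of the plane is the union of the squares with rational centre
    and rational half-side that it contains. *)
Lemma open_measurable_plane (U : set (R * R)) : open U -> measurable U.
Proof.
move=> oU.
pose box (q : rat * rat * rat) : set (R * R) :=
  ball (ratr q.1.1 : R) (ratr q.2) `*` ball (ratr q.1.2 : R) (ratr q.2).
pose F q := if `[< box q `<=` U >] then box q else set0.
have -> : U = \bigcup_q F q; last first.
  apply: countable_bigcupT_measurable; first exact: countableP.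
  move=> q; rewrite /F; case: ifP => _; last exact: measurable0.
  by apply: measurableX; apply: open_measurable; rewrite ball_itv; exact: interval_open.
apply/seteqP; split=> [[x y] Uxy|z [q _]]; last first.
  by rewrite /F; case: ifPn => // /asboolP; apply.
have /nbhs_ballP[e /= e0 eU] := open_nbhs_nbhs (conj oU Uxy).
(* The half-side [r] exceeds the distance from the point to the centre, and
   twice [r] is less than the radius of the given ball. *)
have [r rE] : exists r, ratr r \in `]e / 4, e / 2[ by apply: rat_in_itvoo; lra.
have [q1 q1E] : exists q, ratr q \in `]x - e / 4, x + e / 4[ by apply: rat_in_itvoo; lra.
have [q2 q2E] : exists q, ratr q \in `]y - e / 4, y + e / 4[ by apply: rat_in_itvoo; lra.
move: rE q1E q2E; rewrite !in_itv /= => /andP[r1 r2] /andP[q11 q12] /andP[q21 q22].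
exists (q1, q2, r) => //; rewrite /F.
have xb : box (q1, q2, r) (x, y).
  by split; rewrite /ball /= /ball_ /= ltr_norml; lra.
case: ifPn => // /asboolP; apply: contra_notP => _ [x' y'] /= [].
rewrite /ball /= /ball_ /= !ltr_norml => /andP[? ?] /andP[? ?].
by apply: eU; split; rewrite /ball /= /ball_ /= ltr_norml; lra.
Qed.

Lemma continuous_measurable_plane (f : R * R -> R) :
  continuous f -> measurable_fun setT f.
Proof.
move=> /continuousP cf; apply: (measurability _ (RGenOpens.measurableE R)).
move=> _ [_ [a [b ->] <-]]; rewrite setTI; apply: open_measurable_plane.
exact/cf/interval_open.
Qed.

Lemma Rintegral_half_plane (f : R * R -> R) (N M : R) : 0 <= N ->
  continuous f -> (forall z, `|f z| <= M) ->
  (forall s t, N < `|s| -> f (s, t) = 0) -> (forall s t, N < `|t| -> f (s, t) = 0) ->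
  \int[(mu \x mu)%E]_(z in [set z : R * R | 0 <= z.2]) f z =
  \int[mu]_(t in `[0, +oo[) \int[mu]_s f (s, t).
Proof.
move=> N0 cf fM fs ft.
pose D : set (R * R) := [set z : R * R | 0 <= z.2].
pose A : set (R * R) := `[- N, N]%classic `*` `[0, N]%classic.
have mA : measurable A by apply: measurableX; exact: measurable_itv.
(* On the half-plane the integrand lives in the rectangle [A], which has finite
   measure, so that Fubini's theorem applies. *)
have fDA : f \_ D = f \_ A.
  apply/funext => -[s t]; rewrite !patchE.
  have [tN|] := ltP N `|t|; first by rewrite (ft _ _ tN) !if_same.
  have [sN|] := ltP N `|s|; first by rewrite (fs _ _ sN) !if_same.
  rewrite !ler_norml => /andP[s1 s2] /andP[t1 t2].
  have -> // : ((s, t) \in D) = ((s, t) \in A).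
  apply/idP/idP; rewrite !inE /D /A /= !in_itv /=; last by case=> _ /andP[].
  by move=> t0; split; apply/andP.
have iA : (mu \x mu)%E.-integrable A (EFin \o f).
  apply: measurable_bounded_integrable => //.
  - rewrite [X in (X < _)%E]product_measure1E //.
    have cfin (l u : R) : (mu `[l, u]%classic < +oo)%E.
      exact/compact_finite_measure/segment_compact.
    apply: lte_mul_pinfty => //; last exact: cfin.
    by rewrite ge0_fin_numE //; exact: cfin.
  - apply: measurable_funTS.
    apply: continuous_measurable_plane.
    exact: cf.
  - exists M; split; first by rewrite realE; case: (lerP 0 M) => // /ltW ->; rewrite orbT.
    by move=> B MB z _ /=; rewrite (le_trans (fM z)) // ltW.
have iT : (mu \x mu)%E.-integrable setT (EFin \o (f \_ A)).
  by rewrite -restrict_EFin; apply/integrable_restrict => //; rewrite setTI.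
rewrite Rintegral_mkcond -/D fDA /Rintegral -(integral21_prod_meas1 iT).
congr fine; rewrite [RHS]integral_mkcond; apply: eq_integral => t _.
rewrite patchE /fubini_G /= -fDA; case: ifPn => [|].
  rewrite inE /= in_itv /= andbT => t0.
  have -> : (fun s => ((f \_ D) (s, t))%:E) = (fun s => (f (s, t))%:E).
    by apply/funext => s; rewrite patchE mem_set.
  rewrite fineK //; apply: integrable_fin_num => //.
  apply: (@integrable_compact_support _ _ N (fun s => f (s, t))) => //.
    move=> s; apply: (@continuous_comp _ _ _ (fun s => (s, t)) f); last exact: cf.
    exact: (@cvg_pair R R R (nbhs s) (nbhs s) (nbhs t) _ _ _ id (cst t)
      cvg_id (cvg_cst t)).
  by move=> s; exact: fs.
rewrite notin_setE /= in_itv /= andbT => /negP t0.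
apply: integral0_eq => s _; rewrite patchE memNset //.
exact/negP.
Qed.

End PlaneFubini.

Section WFunction.
Context {R : realType}.
Implicit Types (nu : 'rV[R]_3) (m : oline R).
Variables (v : 'rV[R]_3 -> 'rV[R]_3) (p : 'rV[R]_3 -> R).
Hypothesis hv : smooth_compact_support v.
Hypothesis hp : smooth_compact_support p.
Hypothesis heuler : steady_euler v p.

Lemma halfplane_integral_flux (m : oline R) nu : orthonormal2 (dir m) nu ->
  halfplane_integral v m nu (cross (dir m) nu) = flux v (foot m) (dir m) nu.
Proof.
set e := dir m; set x := foot m => on.
have [ee nn en] := on; have e0 := unit_neq0 ee.
have tT := tame_stress hv 1 e (cross e nu).
have [M M0 HM] := tame_bounded tT; have [_ [r f0]] := tT.
have [N1 N10 HN1] := plane_leaves_ball r `|x| nu (ltr01 : 0 < 1 :> R).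
have [N2 N20 HN2] := plane_leaves_ball r `|x| e (ltr01 : 0 < 1 :> R).
pose f (z : R * R) := stress v e (cross e nu) (x + z.1 *: e + z.2 *: nu).
have cf : continuous f.
  move=> z; apply: (@continuous_comp _ _ _
    (fun z : R * R => x + z.1 *: e + z.2 *: nu) (stress v e (cross e nu))).
    apply: cvgD; [apply: cvgD; [exact: cvg_cst|]|]; apply: cvgZr_tmp.
      exact: cvg_fst.
    exact: cvg_snd.
  exact: tame_cont tT _.
rewrite /halfplane_integral -/e -/x.
have fs (s t : R) : Num.max N1 N2 < `|s| -> f (s, t) = 0.
  rewrite gt_max => /andP[_ Ns]; apply: f0 => /=.
  by apply: (HN2 _ _ _ _ _ (lexx _) en _ Ns); rewrite ee.
have ft (s t : R) : Num.max N1 N2 < `|t| -> f (s, t) = 0.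
  rewrite gt_max => /andP[Nt _]; apply: f0; rewrite /= addrAC.
  have ne : dot nu e = 0 by rewrite dotC.
  by apply: (HN1 _ _ _ _ _ (lexx _) ne _ Nt); rewrite nn.
have N0 : 0 <= Num.max N1 N2 by rewrite le_max N10.
have H := Rintegral_half_plane N0 cf (fun z => HM _) fs ft.
apply: (etrans _ (etrans H _)); first by [].
apply: eq_Rintegral => t _; apply: eq_Rintegral => s _.
by rewrite /f /= addrAC.
Qed.

Lemma wfun_flux (m : oline R) nu k : transverse (dir m) nu ->
  wfun v m = - flux v (foot m + k *: dir m) (dir m) nu.
Proof.
move=> tr; have e0 := unit_neq0 (dir_unit m).
have [hn1 [hn2 ex]] := halfplane_frame_exists m.
have : halfplane_frame m (some_frame m).1 (some_frame m).2.
  exact: (@xgetPex _ (0, 0) [set h : 'rV[R]_3 * 'rV[R]_3 | halfplane_frame m h.1 h.2]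
    (ex_intro _ (hn1, hn2) ex)).
rewrite /wfun; set fr := some_frame m => -[[nn ne] mm [me mn] pos].
have on : orthonormal2 (dir m) fr.1.
  by split; [exact: dir_unit|exact: nn|rewrite dotC].
have n2 : fr.2 = cross (dir m) fr.1 := oriented_frame_cross on mm me mn pos.
rewrite n2 (halfplane_integral_flux on) (flux_shift hv _ _ _ e0).
by rewrite (flux_indep hv hp heuler _ on tr).
Qed.

End WFunction.

(** * The lines near a given line *)

Section UnitSlope.
Context {R : realType}.
Implicit Types (f : 'rV[R]_3 -> R) (c u w x : 'rV[R]_3).

Definition unit_slope c u (s : R) : 'rV[R]_3 :=
  (Num.sqrt (1 + s ^+ 2))^-1 *: (c + s *: u).

(** The chain rule suffices: the inner function has derivative zero at the
    origin. *)
Lemma is_derive_inv_sqrt : is_derive (0 : R) 1 (fun s => (Num.sqrt (1 + s ^+ 2))^-1) 0.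
Proof.
have c0 : (1 + (0 : R) ^+ 2) = 1 by rewrite expr0n addr0.
have s1 : Num.sqrt (1 : R) != 0 by rewrite sqrtr1 oner_neq0.
have dsq : derivable (Num.sqrt : R -> R) 1 1.
  by have [] := is_derive1_sqrt (ltr01 : 0 < 1 :> R).
have dinv : differentiable (fun y : R => (Num.sqrt y)^-1) (1 + 0 ^+ 2 : R).
  by rewrite c0; apply/derivable1_diffP; exact: derivableV.
have dc : is_derive (0 : R) 1 (fun s : R => 1 + s ^+ 2) 0.
  have id0 := is_derive_id (0 : R) 1.
  have := is_deriveD (is_derive_cst (1 : R) (0 : R) 1) (is_deriveM id0 id0).
  by rewrite scale0r !addr0.
have := @is_derive_curve _ _ _ (fun y : R => (Num.sqrt y)^-1)
  (fun s : R => 1 + s ^+ 2) 0 0 dinv dc.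
by rewrite derive0.
Qed.

Lemma slope_neq0 c u s : orthonormal2 c u -> c + s *: u != 0.
Proof.
move=> [cc _ cu]; apply/eqP => E.
have : dot c (c + s *: u) = 1 by rewrite dotC dotDl dotZl cc (dotC u) cu mulr0 addr0.
by rewrite E dotE !mxE !mulr0 !addr0 => /eqP; rewrite eq_sym oner_eq0.
Qed.

Lemma unit_slope0 c u : unit_slope c u 0 = c.
Proof. by rewrite /unit_slope expr0n addr0 sqrtr1 invr1 scale1r scale0r addr0. Qed.

Lemma norm2_gt0 (s : R) : 0 < 1 + s ^+ 2.
Proof. by have := sqr_ge0 s; lra. Qed.

Lemma cross_unit_slope c u w (s : R) : cross (unit_slope c u s) w =
  (Num.sqrt (1 + s ^+ 2))^-1 *: (cross c w + s *: cross u w).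
Proof.
rewrite /unit_slope; set k := (Num.sqrt _)^-1.
by rewrite /cross scale_vec3 add_vec3 scale_vec3 !mxE; congr vec3; ring.
Qed.

Lemma unit_slope_sq (s : R) :
  (1 + s ^+ 2) * ((Num.sqrt (1 + s ^+ 2))^-1 * (Num.sqrt (1 + s ^+ 2))^-1) = 1.
Proof.
have n0 := norm2_gt0 s.
by rewrite -invfM -expr2 sqr_sqrtr ?ltW // mulfV // gt_eqF.
Qed.

(** The integrand may depend on the direction. In the applications it is
    quadratic in the unit vector, possibly up to a term independent of it;
    multiplying by [1 + s ^+ 2] removes the normalisation and leaves a
    polynomial in [s], whose terms of degree 0 and 1 are the only ones that
    matter. By [xray_dilate] the two normalisations together amount to the
    factor [(Num.sqrt (1 + s ^+ 2))^-1], which is stationary at 0. *)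
Lemma derive_xray_unit_slope x c u (f : R -> 'rV[R]_3 -> R) f0 f1 f2 :
  orthonormal2 c u -> tame 1 f0 -> tame 1 f1 -> tame 1 f2 ->
  (forall s y, (1 + s ^+ 2) * f s y = f0 y + s * (f1 y + s * f2 y)) ->
  derive1 (fun s => xray (f s) x (unit_slope c u s)) 0 = xray_moment ('D_u f0) x c + xray f1 x c.
Proof.
move=> on t0 t1 t2 fE.
have fE' s : f s = (1 + s ^+ 2)^-1 \*: (f0 + s \*: (f1 + s \*: f2)).
  apply/funext => y; rewrite -[RHS]/((1 + s ^+ 2)^-1 * (f0 y + s * (f1 y + s * f2 y))).
  by rewrite -fE mulKf // gt_eqF // norm2_gt0.
have t12 s : tame 1 (f1 + s \*: f2) := tameD t1 (tameZ s t2).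
have t012 s : tame 1 (f0 + s \*: (f1 + s \*: f2)) := tameD t0 (tameZ s (t12 s)).
have tf s : tame 1 (f s) by rewrite fE'; exact: tameZ.
pose A s := xray f0 x (c + s *: u) + s * (xray f1 x (c + s *: u) + s * xray f2 x (c + s *: u)).
have -> : (fun s => xray (f s) x (unit_slope c u s)) =
          (fun s => (Num.sqrt (1 + s ^+ 2))^-1 * A s).
  apply/funext => s; have xi0 := slope_neq0 s on.
  set N := Num.sqrt (1 + s ^+ 2).
  have N0 : 0 < N by rewrite sqrtr_gt0 norm2_gt0.
  have N2 : N ^+ 2 = 1 + s ^+ 2 by rewrite sqr_sqrtr // ltW // norm2_gt0.
  have Ni : 0 < N^-1 by rewrite invr_gt0.
  have E : xray (f s) x (unit_slope c u s) = N * xray (f s) x (c + s *: u).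
    by rewrite -(xray_dilate x Ni xi0 (tf s)) mulVKf // gt_eqF.
  rewrite E fE' (xray_scale _ _ xi0 (t012 s)) (xray_add _ xi0 t0 (tameZ _ (t12 s))).
  rewrite (xray_scale _ _ xi0 (t12 s)) (xray_add _ xi0 t1 (tameZ _ t2)) (xray_scale _ _ xi0 t2).
  by rewrite -N2 -/(A s) mulrA expr2 invfM mulVKf // gt_eqF.
have dJ g : tame 1 g ->
    is_derive (0 : R) 1 (fun s => xray g x (c + s *: u)) (xray_moment ('D_u g) x c).
  move=> tg; have xi0 := slope_neq0 0 on.
  by have := xray_derive_dir x xi0 tg; rewrite scale0r addr0.
have id0 := is_derive_id (0 : R) 1.
have dA := is_deriveD (dJ _ t0) (is_deriveM id0 (is_deriveD (dJ _ t1)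
  (is_deriveM id0 (dJ _ t2)))).
have := is_deriveM is_derive_inv_sqrt dA.
rewrite derive1E => -[_ ->].
have c1 : 1 + (0 : R) ^+ 2 = 1 by rewrite expr0n addr0.
rewrite c1 sqrtr1 invr1 !fctE !scaler0 !scale0r !mul0r !addr0 !add0r scale1r.
by rewrite -[_%:A]/(_ * 1) mulr1.
Qed.

End UnitSlope.

Section Motions.
Context {R : realType}.
Implicit Types (g h : motion R) (m : oline R).

Lemma act_motionK g m : act (motion_inv g) (act g m) = m.
Proof.
apply: oline_eqP; first by rewrite /= -mulmxA rot_orth mulmx1.
rewrite !points_act image_comp.
have -> : motion_fun (motion_inv g) \o motion_fun g = id.
  by apply/funext => x; rewrite /= motion_funK.
by rewrite image_id.
Qed.

Lemma motion_to_axisP m : act (motion_to_axis m) m = axis.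
Proof.
have [g gm] := motion_to_axis_exists m.
exact: (@xgetPex _ motion_id [set g | act g m = axis] (ex_intro _ g gm)).
Qed.

Definition mrow h (i : 'I_3) : 'rV[R]_3 := Defs.basis i *m Defs.rot h.

Lemma dot_mrow h i j : dot (mrow h i) (mrow h j) = (i == j)%:R.
Proof. by rewrite dot_rot dot_basis /Defs.basis mxE eqxx /= . Qed.

Lemma mrow_orthonormal h i j : i != j -> orthonormal2 (mrow h i) (mrow h j).
Proof. by move=> /negPf ij; split; rewrite dot_mrow ?eqxx ?ij. Qed.

Lemma mrow_neq0 h i : mrow h i != 0.
Proof. by apply: unit_neq0; rewrite dot_mrow eqxx. Qed.

Lemma mrow_cross01 h : cross (mrow h 0) (mrow h 1) = mrow h 2.
Proof.
apply/esym; apply: oriented_frame_cross (@mrow_orthonormal h 0 1 isT) _ _ _ _; rewrite ?dot_mrow //.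
rewrite /positively_oriented.
have -> : rows3 (mrow h 0) (mrow h 1) (mrow h 2) = Defs.rot h.
  apply/row_matrixP => i.
  rewrite /mrow -!rowE; apply/rowP => j; rewrite !mxE.
  by case: i => [[|[|[|//]]] hi] /=; rewrite !mxE; congr (Defs.rot h _ _); apply: val_inj.
by rewrite rot_det ltr01.
Qed.

Lemma mrow_cross12 h : cross (mrow h 1) (mrow h 2) = mrow h 0.
Proof.
rewrite -mrow_cross01 (crossC (mrow h 0)) crossNr.
by rewrite cross_cross_orthonormal ?opprK //; exact: mrow_orthonormal.
Qed.

Lemma mrow_cross20 h : cross (mrow h 2) (mrow h 0) = mrow h 1.
Proof.
rewrite crossC -mrow_cross01.
by rewrite cross_cross_orthonormal ?opprK //; exact: mrow_orthonormal.
Qed.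

Definition frame_dir h (a1 a2 : R) : 'rV[R]_3 :=
  (Num.sqrt (1 + a1 ^+ 2 + a2 ^+ 2))^-1 *: (mrow h 2 + a1 *: mrow h 0 + a2 *: mrow h 1).

Definition frame_pt h (y1 y2 : R) : 'rV[R]_3 := Defs.trans h + y1 *: mrow h 0 + y2 *: mrow h 1.

Lemma dir_act_coord h y1 y2 a1 a2 : dir (act h (Defs.coord y1 y2 a1 a2)) = frame_dir h a1 a2.
Proof.
rewrite /= /coord_dir /frame_dir -scalemxAl; congr (_ *: _).
rewrite vec3_basis !mulmxDl -!scalemxAl scale1r -/(mrow h 0) -/(mrow h 1) -/(mrow h 2).
by rewrite addrC addrA.
Qed.

(** The point with coordinates y1, y2 lies on the line; the foot differs from it
    by a multiple of the direction, which integrals over the line ignore. *)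
Lemma foot_act_coord h y1 y2 a1 a2 :
  exists k, foot (act h (Defs.coord y1 y2 a1 a2)) + k *: frame_dir h a1 a2 = frame_pt h y1 y2.
Proof.
set m := Defs.coord _ _ _ _.
have dE : dir m *m Defs.rot h = frame_dir h a1 a2 by rewrite -(dir_act_coord h y1 y2).
exists (dot (motion_fun h (foot m)) (dir m *m Defs.rot h) + dot (vec3 y1 y2 0) (dir m)).
have -> : foot (act h m) = motion_fun h (foot m)
  - dot (motion_fun h (foot m)) (dir m *m Defs.rot h) *: (dir m *m Defs.rot h) by [].
have -> : foot m = vec3 y1 y2 0 - dot (vec3 y1 y2 0) (dir m) *: dir m by [].
set k2 := dot _ (dir m *m _); set k1 := dot _ (dir m).
rewrite dE scalerDl addrA subrK /motion_fun mulmxBl -scalemxAl dE addrAC subrK.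
rewrite vec3_basis !mulmxDl -!scalemxAl scale0r addr0 /frame_pt -/(mrow h 0) -/(mrow h 1).
by rewrite addrC addrA.
Qed.

Lemma frame_pt00 h : frame_pt h 0 0 = Defs.trans h.
Proof. by rewrite /frame_pt !scale0r !addr0. Qed.

Lemma frame_ptC h y1 y2 :
  frame_pt h y1 y2 = (Defs.trans h + y2 *: mrow h 1) + y1 *: mrow h 0.
Proof. by rewrite /frame_pt addrAC. Qed.

Lemma frame_dir_unit h a1 a2 : dot (frame_dir h a1 a2) (frame_dir h a1 a2) = 1.
Proof. by rewrite -(dir_act_coord h 0 0); exact: dir_unit. Qed.

Lemma dot_frame_dir h a1 a2 (w : 'rV[R]_3) : dot w (frame_dir h a1 a2) =
  (Num.sqrt (1 + a1 ^+ 2 + a2 ^+ 2))^-1 *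
  (dot w (mrow h 2) + a1 * dot w (mrow h 0) + a2 * dot w (mrow h 1)).
Proof. by rewrite dotC /frame_dir dotZl !dotDl !dotZl !(dotC _ w). Qed.

Lemma transverse_frame_dir0 h a1 a2 : transverse (frame_dir h a1 a2) (mrow h 0).
Proof.
split; first exact/unit_neq0/frame_dir_unit.
exists (mrow h 0 - a1 *: mrow h 2).
  by rewrite dotDl dotNl dotZl !dot_frame_dir !dot_mrow /=; ring.
by rewrite dotDl dotNl dotZl !dot_mrow /= mulr0 subr0 ltr01.
Qed.

Lemma transverse_frame_dir1 h a1 a2 : transverse (frame_dir h a1 a2) (mrow h 1).
Proof.
split; first exact/unit_neq0/frame_dir_unit.
exists (mrow h 1 - a2 *: mrow h 2).
  by rewrite dotDl dotNl dotZl !dot_frame_dir !dot_mrow /=; ring.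
by rewrite dotDl dotNl dotZl !dot_mrow /= mulr0 subr0 ltr01.
Qed.

Lemma frame_dirE1 h s : frame_dir h 0 s = unit_slope (mrow h 2) (mrow h 1) s.
Proof. by rewrite /frame_dir /unit_slope expr0n addr0 scale0r addr0. Qed.

Lemma frame_dirE0 h s : frame_dir h s 0 = unit_slope (mrow h 2) (mrow h 0) s.
Proof. by rewrite /frame_dir /unit_slope expr0n addr0 scale0r addr0. Qed.

Lemma frame_dir0 h : frame_dir h 0 0 = mrow h 2.
Proof. by rewrite frame_dirE1 unit_slope0. Qed.

End Motions.

(** * The operators P and Delta_M applied to w *)

Section OperatorsOnW.
Context {R : realType}.
Implicit Types (c d u w x e nu : 'rV[R]_3) (h : motion R) (m : oline R).
Variables (v : 'rV[R]_3 -> 'rV[R]_3) (p : 'rV[R]_3 -> R).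
Hypothesis hv : smooth_compact_support v.
Hypothesis hp : smooth_compact_support p.
Hypothesis heuler : steady_euler v p.

Let tT k d n : tame k (stress v d n). Proof. exact: tame_stress. Qed.

Definition wcoord h y1 y2 a1 a2 : R := wfun v (act h (Defs.coord y1 y2 a1 a2)).

Lemma wcoord_flux h y1 y2 a1 a2 nu : transverse (frame_dir h a1 a2) nu ->
  wcoord h y1 y2 a1 a2 = - flux v (frame_pt h y1 y2) (frame_dir h a1 a2) nu.
Proof.
move=> tr; have [k kE] := foot_act_coord h y1 y2 a1 a2.
rewrite -(dir_act_coord h y1 y2) in tr kE *.
by rewrite /wcoord (wfun_flux hv hp heuler k tr) kE.
Qed.

Lemma dy1_wcoord h : dy1 (wcoord h) = fun y1 y2 a1 a2 =>
  xray (stress v (frame_dir h a1 a2) (cross (frame_dir h a1 a2) (mrow h 0)))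
    (frame_pt h y1 y2) (frame_dir h a1 a2).
Proof.
apply/funext => y1; apply/funext => y2; apply/funext => a1; apply/funext => a2.
set e := frame_dir h a1 a2; have tr := transverse_frame_dir0 h a1 a2.
rewrite /dy1.
(* The ray may be taken along the first coordinate direction, so that moving the
   base point in this direction only shortens the ray. *)
have -> : (fun s => wcoord h s y2 a1 a2) =
    - (fun s => flux v ((Defs.trans h + y2 *: mrow h 1) + s *: mrow h 0) e (mrow h 0)).
  by apply/funext => s; rewrite (wcoord_flux _ _ tr) frame_ptC.
have := is_deriveN (ray_xray_derive_along (Defs.trans h + y2 *: mrow h 1) y1 tr
  (tT 2 e (cross e (mrow h 0)))).
by rewrite derive1E => -[_ ->]; rewrite opprK -frame_ptC.
Qed.

Lemma dy2_wcoord h : dy2 (wcoord h) = fun y1 y2 a1 a2 =>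
  xray (stress v (frame_dir h a1 a2) (cross (frame_dir h a1 a2) (mrow h 1)))
    (frame_pt h y1 y2) (frame_dir h a1 a2).
Proof.
apply/funext => y1; apply/funext => y2; apply/funext => a1; apply/funext => a2.
set e := frame_dir h a1 a2; have tr := transverse_frame_dir1 h a1 a2.
rewrite /dy2.
have -> : (fun s => wcoord h y1 s a1 a2) =
    - (fun s => flux v ((Defs.trans h + y1 *: mrow h 0) + s *: mrow h 1) e (mrow h 1)).
  by apply/funext => s; rewrite (wcoord_flux _ _ tr).
have := is_deriveN (ray_xray_derive_along (Defs.trans h + y1 *: mrow h 0) y2 tr
  (tT 2 e (cross e (mrow h 1)))).
by rewrite derive1E => -[_ ->]; rewrite opprK.
Qed.

Lemma stress_unit_slope_cross c u w (s : R) y :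
  (1 + s ^+ 2) * stress v (unit_slope c u s) (cross (unit_slope c u s) w) y =
  (dot c (v y) + s * dot u (v y)) * (dot (cross c w) (v y) + s * dot (cross u w) (v y)).
Proof.
rewrite cross_unit_slope stressE /unit_slope !dotZl !dotDl !dotZl.
rewrite mulrACA [LHS]mulrA unit_slope_sq mul1r //.
Qed.

Lemma stress_unit_slope c u (s : R) y :
  (1 + s ^+ 2) * stress v (unit_slope c u s) (unit_slope c u s) y =
  (dot c (v y) + s * dot u (v y)) * (dot c (v y) + s * dot u (v y)).
Proof.
rewrite stressE /unit_slope !dotZl !dotDl !dotZl.
by rewrite mulrACA [LHS]mulrA unit_slope_sq mul1r.
Qed.

Section Frame.
Variable h : motion R.
Let a := mrow h 0.
Let b := mrow h 1.
Let c := mrow h 2.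
Let x0 := Defs.trans h.

Let c0 : c != 0 := mrow_neq0 h 2.

Lemma da2_dy1_wcoord : da2 (dy1 (wcoord h)) 0 0 0 0 =
  xray_moment ('D_b (stress v c b)) x0 c + xray (stress v b b + (-1) \*: stress v c c) x0 c.
Proof.
rewrite dy1_wcoord /da2 frame_pt00.
under eq_fun do rewrite frame_dirE1.
apply: (@derive_xray_unit_slope _ _ _ _
  (fun s => stress v (unit_slope c b s) (cross (unit_slope c b s) a))
  _ _ ((-1) \*: stress v b c) (@mrow_orthonormal R h 2 1 isT) (tT 1 _ _)
  (tameD (tT 1 _ _) (tameZ _ (tT 1 _ _))) (tameZ _ (tT 1 _ _))).
move=> s y; rewrite stress_unit_slope_cross mrow_cross20 (crossC b a) mrow_cross01.
by rewrite !fctE !scalefE !stressE dotNl; ring.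
Qed.

Lemma da1_dy2_wcoord : da1 (dy2 (wcoord h)) 0 0 0 0 =
  xray_moment ('D_a ((-1) \*: stress v c a)) x0 c + xray (stress v c c + (-1) \*: stress v a a) x0 c.
Proof.
rewrite dy2_wcoord /da1 frame_pt00.
under eq_fun do rewrite frame_dirE0.
apply: (@derive_xray_unit_slope _ _ _ _
  (fun s => stress v (unit_slope c a s) (cross (unit_slope c a s) b))
  _ _ (stress v a c) (@mrow_orthonormal R h 2 0 isT) (tameZ _ (tT 1 _ _))
  (tameD (tT 1 _ _) (tameZ _ (tT 1 _ _))) (tT 1 _ _)).
move=> s y; rewrite stress_unit_slope_cross mrow_cross01 (crossC c b) mrow_cross12.
by rewrite !fctE !scalefE !stressE dotNl; ring.
Qed.

Lemma Lap0_wcoord : dy1 (dy1 (wcoord h)) 0 0 0 0 + dy2 (dy2 (wcoord h)) 0 0 0 0 =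
  xray ('D_a (stress v c b)) x0 c - xray ('D_b (stress v c a)) x0 c.
Proof.
rewrite dy1_wcoord dy2_wcoord /dy1 /dy2 frame_dir0 -/c -/a -/b mrow_cross20.
rewrite (crossC c b) mrow_cross12.
have TN : stress v c (- a) = (-1) \*: stress v c a.
  by apply/funext => y; rewrite scalefE !stressE dotNl; ring.
rewrite TN; congr (_ + _).
  have -> : (fun s => xray (stress v c b) (frame_pt h s 0) c) =
            (fun s => xray (stress v c b) (x0 + s *: a) c).
    by apply/funext => s; rewrite /frame_pt scale0r addr0.
  rewrite derive1E; have [_ ->] := xray_derive_pt x0 a 0 c0 (tT 1 c b).
  by rewrite scale0r addr0.
have -> : (fun s => xray ((-1) \*: stress v c a) (frame_pt h 0 s) c) =
          - (fun s => xray (stress v c a) (x0 + s *: b) c).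
  apply/funext => s; rewrite /frame_pt scale0r addr0.
  by rewrite (xray_scale _ _ c0 (tT 1 c a)) mulN1r.
rewrite derive1E; have [_ ->] := is_deriveN (xray_derive_pt x0 b 0 c0 (tT 1 c a)).
by rewrite scale0r addr0.
Qed.

End Frame.

(** The trace of the momentum flux plus the pressure. It does not involve the
    direction of the line. *)
Definition isotropic_part : 'rV[R]_3 -> R := fun x => dot (v x) (v x) + p x.

(** The integrand of P w over a line of direction [e]. *)
Definition reduced_field e : 'rV[R]_3 -> R := isotropic_part + (-2) \*: stress v e e.

Lemma tame_isotropic_part k : tame k isotropic_part.
Proof.
have -> : isotropic_part = stress v (Defs.basis 0) (Defs.basis 0) + stress v (Defs.basis 1) (Defs.basis 1)
            + stress v (Defs.basis 2) (Defs.basis 2) + p.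
  by apply/funext => y; rewrite /isotropic_part !fctE !stressE !dot_basis dotE.
by do !apply: tameD => //; exact: tame_p.
Qed.

Lemma tame_reduced_field k e : tame k (reduced_field e).
Proof. exact: tameD (tame_isotropic_part k) (tameZ _ (tT k _ _)). Qed.

Lemma parseval h y : dot (v y) (v y) =
  dot (mrow h 0) (v y) ^+ 2 + dot (mrow h 1) (v y) ^+ 2 + dot (mrow h 2) (v y) ^+ 2.
Proof.
have := gram (mrow h 0) (mrow h 1) (v y).
rewrite mrow_cross01 !dot_mrow /= !(dotC (v y) (mrow _ _)) => ->; ring.
Qed.

(** The moments add up to that of - D_c (T(c, c) + p), which integrates by parts
    to X (T(c, c) + p); by [parseval] the total is X (|v|^2 + p - 2 T(c, c)). *)
Lemma L0_wcoord h :
  da2 (dy1 (wcoord h)) 0 0 0 0 - da1 (dy2 (wcoord h)) 0 0 0 0 =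
  xray (reduced_field (mrow h 2)) (Defs.trans h) (mrow h 2).
Proof.
rewrite da2_dy1_wcoord da1_dy2_wcoord.
set a := mrow h 0; set b := mrow h 1; set c := mrow h 2; set x0 := Defs.trans h.
have c0 : c != 0 := mrow_neq0 h 2.
pose g := stress v c c + p.
have tg k : tame k g by apply: tameD => //; exact: tame_p.
have div : 'D_a (stress v c a) + 'D_b (stress v c b) = (-1) \*: 'D_c g.
  apply/funext => y; have := divergence_frame hv hp heuler c a b c y.
  rewrite mrow_cross12 mrow_cross20 mrow_cross01 dot_mrow mulN1r.
  rewrite scalefE !fctE.
  have -> : 'D_c g y = 'D_c (stress v c c) y + 'D_c p y.
    have dT := diff_derivable (v := c) (tame_diff y (tT 1 c c)).
    have dp := diff_derivable (v := c) (tame_diff y (tame_p hp 1)).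
    exact: (@derive_val _ _ _ _ _ _ _ (is_deriveD (derivableP dT) (derivableP dp))).
  by move=> E; rewrite mulN1r opprD -E [RHS]addrC addrK.
have E1 : xray_moment ('D_b (stress v c b)) x0 c
    - xray_moment ('D_a ((-1) \*: stress v c a)) x0 c = xray g x0 c.
  have -> : 'D_a ((-1) \*: stress v c a) = (-1) \*: 'D_a (stress v c a).
    apply/funext => y; rewrite deriveZ //.
    exact: (diff_derivable (tame_diff y (tT 1 c a))).
  have ta := tame_derive a (tT 1 c a); have tb := tame_derive b (tT 1 c b).
  rewrite (xray_moment_scale _ _ c0 ta) mulN1r opprK addrC -(xray_moment_add _ c0 ta tb) div.
  rewrite (xray_moment_scale _ _ c0 (tame_derive c (tg 1%N))).
  by rewrite (xray_moment_derive_along _ c0 (tg 1%N)) mulN1r opprK.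
rewrite opprD addrACA E1 (xray_add _ c0 (tT 0 b b) (tameZ _ (tT 0 c c))).
rewrite (xray_add _ c0 (tT 0 c c) (tameZ _ (tT 0 a a))).
rewrite (xray_scale _ _ c0 (tT 0 c c)) (xray_scale _ _ c0 (tT 0 a a)).
have -> : reduced_field c = g + (stress v a a + (stress v b b + (-2) \*: stress v c c)).
  apply/funext => y; rewrite /reduced_field /g !fctE !scalefE /isotropic_part.
  by rewrite !stressE (parseval h y) -/a -/b -/c; ring.
have tcc := tT 0 c c; have tbb := tT 0 b b; have taa := tT 0 a a.
have t2 := tameD tbb (tameZ (-2) tcc).
rewrite (xray_add _ c0 (tg 0%N) (tameD taa t2)) (xray_add _ c0 taa t2).
rewrite (xray_add _ c0 tbb (tameZ (-2) tcc)) (xray_scale _ _ c0 tcc).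
move: (xray g x0 c) (xray _ x0 c) (xray _ x0 c) (xray _ x0 c) => *; ring.
Qed.

Definition xray_reduced m : R := xray (reduced_field (dir m)) (foot m) (dir m).

Lemma P_wfun : P (wfun v) = xray_reduced.
Proof.
apply/funext => m; rewrite /P /L0; set h := motion_inv (motion_to_axis m).
have -> : in_coord (transport (wfun v) (motion_to_axis m)) = wcoord h by [].
rewrite L0_wcoord.
have mE : m = act h (Defs.coord 0 0 0 0).
  by rewrite -/axis -(motion_to_axisP m) act_motionK.
have [k kE] := foot_act_coord h 0 0 0 0.
have dE := dir_act_coord h 0 0 0 0.
rewrite -mE in kE dE; rewrite frame_dir0 in kE dE.
rewrite frame_pt00 in kE.
have c0 := mrow_neq0 h 2.
by rewrite /xray_reduced dE -kE (xray_shift _ _ c0 (tame_reduced_field 1 _)).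
Qed.

Definition rcoord h y1 y2 a1 a2 : R := xray_reduced (act h (Defs.coord y1 y2 a1 a2)).

Lemma rcoord_xray h y1 y2 a1 a2 : rcoord h y1 y2 a1 a2 =
  xray (reduced_field (frame_dir h a1 a2)) (frame_pt h y1 y2) (frame_dir h a1 a2).
Proof.
rewrite /rcoord /xray_reduced dir_act_coord; have [k <-] := foot_act_coord h y1 y2 a1 a2.
by rewrite (xray_shift _ _ (unit_neq0 (frame_dir_unit h a1 a2)) (tame_reduced_field 1 _)).
Qed.

Lemma dy1_rcoord h y1 y2 a1 a2 : dy1 (rcoord h) y1 y2 a1 a2 =
  xray ('D_(mrow h 0) (reduced_field (frame_dir h a1 a2))) (frame_pt h y1 y2) (frame_dir h a1 a2).
Proof.
set e := frame_dir h a1 a2; have e0 : e != 0 := unit_neq0 (frame_dir_unit h a1 a2).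
rewrite /dy1.
have -> : (fun s => rcoord h s y2 a1 a2) =
    (fun s => xray (reduced_field e) ((Defs.trans h + y2 *: mrow h 1) + s *: mrow h 0) e).
  by apply/funext => s; rewrite rcoord_xray frame_ptC.
rewrite derive1E; have [_ ->] := xray_derive_pt (Defs.trans h + y2 *: mrow h 1) (mrow h 0) y1 e0
  (tame_reduced_field 1 e).
by rewrite -frame_ptC.
Qed.

Lemma dy2_rcoord h y1 y2 a1 a2 : dy2 (rcoord h) y1 y2 a1 a2 =
  xray ('D_(mrow h 1) (reduced_field (frame_dir h a1 a2))) (frame_pt h y1 y2) (frame_dir h a1 a2).
Proof.
set e := frame_dir h a1 a2; have e0 : e != 0 := unit_neq0 (frame_dir_unit h a1 a2).
rewrite /dy2.
have -> : (fun s => rcoord h y1 s a1 a2) =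
    (fun s => xray (reduced_field e) ((Defs.trans h + y1 *: mrow h 0) + s *: mrow h 1) e).
  by apply/funext => s; rewrite rcoord_xray.
by rewrite derive1E; have [_ ->] := xray_derive_pt (Defs.trans h + y1 *: mrow h 0) (mrow h 1) y2 e0
  (tame_reduced_field 1 e).
Qed.

(** As the isotropic part does not depend on the direction, its quadratic
    expansion [(1 + s ^+ 2) * isotropic_part] is shared between the terms of
    degree 0 and 2; the term of degree 1 comes from T(e, e) alone. *)
Lemma derive_reduced_field_unit_slope c u w (s : R) y :
  (1 + s ^+ 2) * 'D_w (reduced_field (unit_slope c u s)) y =
  'D_w (reduced_field c) y + s * (((-4) \*: 'D_w (stress v c u)) y + s * 'D_w (reduced_field u) y).
Proof.
have tr e := tame_reduced_field 1 e.
(* The summand with coefficient 0 gives both sides the shape of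
   [tame_derive_lin]. *)
have E : reduced_field c + s \*: (s \*: reduced_field u + (-4) \*: stress v c u)
    = 0 \*: reduced_field c + (1 + s ^+ 2) \*: reduced_field (unit_slope c u s).
  apply/funext => z; rewrite !fctE !scalefE mul0r add0r /reduced_field !fctE !scalefE.
  rewrite [RHS]mulrDr [X in _ = _ + X]mulrCA stress_unit_slope !stressE; ring.
have t1 := tameD (tameZ s (tr u)) (tameZ (-4) (tT 1 c u)).
have := tame_derive_lin s w (tr c) t1; rewrite E.
rewrite (tame_derive_lin _ w (tameZ 0 (tr c)) (tr _)).
rewrite (tame_derive_lin (-4) w (tameZ s (tr u)) (tT 1 c u)) => /(congr1 (fun F => F y)).
rewrite !fctE !scalefE.
have Z k f : tame 1 f -> 'D_w (k \*: f) y = k * 'D_w f y.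
  by move=> tf; rewrite deriveZ //; exact: (diff_derivable (tame_diff y tf)).
rewrite !(Z _ _ (tr _)) mul0r add0r => ->.
by rewrite [s * _ + _]addrC.
Qed.

(** The two moments agree because second derivatives commute. *)
Lemma L0_rcoord h :
  da2 (dy1 (rcoord h)) 0 0 0 0 - da1 (dy2 (rcoord h)) 0 0 0 0 =
  -4 * (xray ('D_(mrow h 0) (stress v (mrow h 2) (mrow h 1))) (Defs.trans h) (mrow h 2)
        - xray ('D_(mrow h 1) (stress v (mrow h 2) (mrow h 0))) (Defs.trans h) (mrow h 2)).
Proof.
set a := mrow h 0; set b := mrow h 1; set c := mrow h 2; set x0 := Defs.trans h.
have c0 : c != 0 := mrow_neq0 h 2.
have tr e u : tame 1 ('D_u (reduced_field e)) := tame_derive u (tame_reduced_field 2 e).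
have tTd u d n : tame 1 ('D_u (stress v d n)) := tame_derive u (tT 2 d n).
have -> : da2 (dy1 (rcoord h)) 0 0 0 0 =
    xray_moment ('D_b ('D_a (reduced_field c))) x0 c + xray ((-4) \*: 'D_a (stress v c b)) x0 c.
  rewrite /da2; under eq_fun do rewrite dy1_rcoord frame_pt00 frame_dirE1.
  apply: (@derive_xray_unit_slope _ _ _ _ (fun s => 'D_a (reduced_field (unit_slope c b s)))
    _ _ ('D_a (reduced_field b)) (@mrow_orthonormal R h 2 1 isT)
    (tr _ _) (tameZ _ (tTd _ _ _)) (tr _ _)).
  exact: (fun s y => derive_reduced_field_unit_slope c b a s y).
have E2 : da1 (dy2 (rcoord h)) 0 0 0 0 =
    xray_moment ('D_a ('D_b (reduced_field c))) x0 c + xray ((-4) \*: 'D_b (stress v c a)) x0 c.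
  rewrite /da1; under eq_fun do rewrite dy2_rcoord frame_pt00 frame_dirE0.
  apply: (@derive_xray_unit_slope _ _ _ _ (fun s => 'D_b (reduced_field (unit_slope c a s)))
    _ _ ('D_b (reduced_field a)) (@mrow_orthonormal R h 2 0 isT)
    (tr _ _) (tameZ _ (tTd _ _ _)) (tr _ _)).
  exact: (fun s y => derive_reduced_field_unit_slope c a b s y).
have DD : 'D_a ('D_b (reduced_field c)) = 'D_b ('D_a (reduced_field c)).
  by apply/funext => y; exact: (derive_comm b a y (tame_reduced_field 2 c).1).
rewrite (etrans E2 (congr1
  (fun F => xray_moment F x0 c + xray ((-4) \*: 'D_b (stress v c a)) x0 c) DD)).
rewrite (xray_scale _ _ c0 (tTd a c b)) (xray_scale _ _ c0 (tTd b c a)).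
move: (xray_moment _ _ _) (xray _ _ _) (xray _ _ _) => A B C; ring.
Qed.

End OperatorsOnW.

Theorem proposition4p3 (R : realType)
    (v : 'rV[R]_3 -> 'rV[R]_3) (p : 'rV[R]_3 -> R)
    (hv : smooth_compact_support v) (hp : smooth_compact_support p)
    (heuler : steady_euler v p) :
  forall m : oline R, P (P (wfun v)) m = - 4 * DeltaM (wfun v) m.
Proof.
move=> m; rewrite (P_wfun hv hp heuler); set h := motion_inv (motion_to_axis m).
have -> : P (xray_reduced v p) m =
    da2 (dy1 (rcoord v p h)) 0 0 0 0 - da1 (dy2 (rcoord v p h)) 0 0 0 0.
  by [].
rewrite (L0_rcoord hv hp).
have -> : DeltaM (wfun v) m =
    dy1 (dy1 (wcoord v h)) 0 0 0 0 + dy2 (dy2 (wcoord v h)) 0 0 0 0.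
  by [].
by rewrite (Lap0_wcoord hv hp heuler).
Qed.
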